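(* Let $A$ be a cosemisimple Hopf algebra over an algebraically closed field $k$. If $\mathrm{cd}_{\rm GS}(A)$ is finite, then $\mathrm{cd}(A)=\mathrm{cd}_{\rm GS}(A)$.
   Context: For an algebra $A$, $\mathrm{cd}(A)\in\mathbb N\cup\{\infty\}$ is the Hochschild cohomological dimension, i.e. the projective dimension of $A$ in the category of $A$-bimodules; for a Hopf algebra it equals the global dimension and the projective dimension of the trivial $A$-module. A (right-right) Yetter-Drinfeld module over a Hopf algebra $A$ is a right $A$-comodule and right $A$-module $V$ such that for all $v\in V$, $a\in A$: $(v\cdot a)_{(0)}\otimes(v\cdot a)_{(1)}=v_{(0)}\cdot a_{(2)}\otimes S(a_{(1)})v_{(1)}a_{(3)}$. The category $\mathcal{YD}_A^A$ of Yetter-Drinfeld modules, with $A$-linear and $A$-colinear maps as morphisms, is abelian and has enough injective objects; $k$ denotes the trivial Yetter-Drinfeld module. The Gerstenhaber-Schack cohomological dimension is $$\mathrm{cd}_{\rm GS}(A)=\max\{n:\ \mathrm{Ext}^n_{\mathcal{YD}_A^A}(k,V)\neq 0 \text{ for some } V\in\mathcal{YD}_A^A\}\in\mathbb N\cup\{\infty\}.$$ *)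

(* Defs.v *)
From HB Require Import structures.
From mathcomp Require Import all_boot all_order all_algebra.
From mathcomp Require Import boolp.

Set Implicit Arguments.
Unset Strict Implicit.
Unset Printing Implicit Defensive.

Import GRing.Theory.
Local Open Scope ring_scope.
Local Open Scope quotient_scope.

Reserved Notation "x ⊗ y" (at level 40, left associativity).
Reserved Notation "\sw_ ( x , y <- t ) E"
  (at level 41, x name, y name, t at level 200, E at level 41, right associativity,
   format "\sw_ ( x ,  y  <-  t )  E").

Section Tensor.
Context {k : fieldType}.

Definition bilinear_map {V W U : lmodType k} (b : V -> W -> U) : Prop :=
  (forall w, linear (b^~ w)) /\ (forall v, linear (b v)).

Section Construction.
Variables V W : lmodType k.

Definition tsum (U : lmodType k) (b : V -> W -> U) (s : seq (V * W)) : U :=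
  \sum_(p <- s) b p.1 p.2.

(* The list [(v1, w1); ...; (vn, wn)] stands for v1 ⊗ w1 + ... + vn ⊗ wn; two
   lists are identified when no bilinear map out of V x W separates them. *)
Definition tensor_rel (s t : seq (V * W)) : bool :=
  `[< forall (U : lmodType k) (b : V -> W -> U),
        bilinear_map b -> tsum b s = tsum b t >].

Lemma tensor_rel_refl : reflexive tensor_rel.
Proof. by move=> s; apply/asboolP. Qed.

Lemma tensor_rel_sym : symmetric tensor_rel.
Proof. by move=> s t; apply/asboolP/asboolP => h U b hb; rewrite h. Qed.

Lemma tensor_rel_trans : transitive tensor_rel.
Proof.
move=> t s u /asboolP h1 /asboolP h2; apply/asboolP => U b hb.
by rewrite h1 // h2.
Qed.

Canonical tensor_equiv :=
  EquivRel tensor_rel tensor_rel_refl tensor_rel_sym tensor_rel_trans.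

Definition tensor := {eq_quot tensor_equiv}.
HB.instance Definition _ := Choice.on tensor.

Definition sweedler (t : tensor) (U : lmodType k) (b : V -> W -> U) : U :=
  tsum b (repr t).

Lemma tensor_eqP (s t : seq (V * W)) :
  (forall (U : lmodType k) (b : V -> W -> U),
     bilinear_map b -> tsum b s = tsum b t) <->
  \pi_tensor s = \pi_tensor t.
Proof.
split=> [h|/eqP]; first by apply/eqmodP/asboolP.
by rewrite eqmodE => /asboolP.
Qed.

Lemma sweedler_pi (U : lmodType k) (b : V -> W -> U) s :
  bilinear_map b -> sweedler (\pi_tensor s) b = tsum b s.
Proof.
move=> hb; rewrite /sweedler.
by have /tensor_eqP -> // : \pi_tensor (repr (\pi_tensor s)) = \pi_tensor s
  by rewrite reprK.
Qed.

Lemma tsum_cat (U : lmodType k) (b : V -> W -> U) s t :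
  tsum b (s ++ t) = tsum b s + tsum b t.
Proof. by rewrite /tsum big_cat. Qed.

Definition tscale (c : k) (s : seq (V * W)) := [seq (c *: p.1, p.2) | p <- s].

Lemma tsum_scale (U : lmodType k) (b : V -> W -> U) c s :
  bilinear_map b -> tsum b (tscale c s) = c *: tsum b s.
Proof.
move=> [hl _]; rewrite /tsum big_map scaler_sumr; apply: eq_bigr => p _ /=.
by have := GRing.scalable_linear (hl p.2) c p.1.
Qed.

Lemma tensor_sepP (x y : tensor) :
  (forall (U : lmodType k) (b : V -> W -> U),
     bilinear_map b -> sweedler x b = sweedler y b) -> x = y.
Proof.
move=> h; rewrite -[x]reprK -[y]reprK; apply/tensor_eqP => U b hb.
exact: h.
Qed.

Definition tensor_zero : tensor := \pi_tensor [::].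
Definition tensor_add (x y : tensor) : tensor := \pi_tensor (repr x ++ repr y).
Definition tensor_scale (c : k) (x : tensor) : tensor := \pi_tensor (tscale c (repr x)).
Definition tensor_opp (x : tensor) : tensor := tensor_scale (-1) x.

Lemma sweedler0_ (U : lmodType k) (b : V -> W -> U) :
  bilinear_map b -> sweedler tensor_zero b = 0.
Proof. by move=> hb; rewrite sweedler_pi // /tsum big_nil. Qed.

Lemma sweedlerD_ (U : lmodType k) (b : V -> W -> U) x y :
  bilinear_map b -> sweedler (tensor_add x y) b = sweedler x b + sweedler y b.
Proof. by move=> hb; rewrite sweedler_pi // tsum_cat. Qed.

Lemma sweedlerZ_ (U : lmodType k) (b : V -> W -> U) c x :
  bilinear_map b -> sweedler (tensor_scale c x) b = c *: sweedler x b.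
Proof. by move=> hb; rewrite sweedler_pi // tsum_scale. Qed.

Lemma tensor_addA : associative tensor_add.
Proof. by move=> x y z; apply: tensor_sepP => U b hb; rewrite !sweedlerD_ ?addrA. Qed.

Lemma tensor_addC : commutative tensor_add.
Proof. by move=> x y; apply: tensor_sepP => U b hb; rewrite !sweedlerD_ // addrC. Qed.

Lemma tensor_add0 : left_id tensor_zero tensor_add.
Proof.
by move=> x; apply: tensor_sepP => U b hb; rewrite sweedlerD_ // sweedler0_ // add0r.
Qed.

Lemma tensor_addN : left_inverse tensor_zero tensor_opp tensor_add.
Proof.
move=> x; apply: tensor_sepP => U b hb.
by rewrite sweedlerD_ // sweedlerZ_ // sweedler0_ // scaleN1r addNr.
Qed.

HB.instance Definition _ :=
  GRing.isZmodule.Build tensor tensor_addA tensor_addC tensor_add0 tensor_addN.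

Lemma tensor_scaleA (c d : k) (x : tensor) :
  tensor_scale c (tensor_scale d x) = tensor_scale (c * d) x.
Proof. by apply: tensor_sepP => U b hb; rewrite !sweedlerZ_ // scalerA. Qed.

Lemma tensor_scale1 : left_id 1 tensor_scale.
Proof. by move=> x; apply: tensor_sepP => U b hb; rewrite sweedlerZ_ // scale1r. Qed.

Lemma tensor_scaleDr : right_distributive tensor_scale +%R.
Proof.
move=> c x y; apply: tensor_sepP => U b hb.
by rewrite sweedlerZ_ // !sweedlerD_ // !sweedlerZ_ // scalerDr.
Qed.

Lemma tensor_scaleDl (x : tensor) : {morph tensor_scale^~ x : c d / c + d}.
Proof.
move=> c d; apply: tensor_sepP => U b hb.
by rewrite sweedlerD_ // !sweedlerZ_ // scalerDl.
Qed.

HB.instance Definition _ := GRing.Zmodule_isLmodule.Build k tensor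
  tensor_scaleA tensor_scale1 tensor_scaleDr tensor_scaleDl.

Definition tens (v : V) (w : W) : tensor := \pi_tensor [:: (v, w)].

End Construction.

Local Notation "x ⊗ y" := (tens x y) : ring_scope.

Section LinearOf.
Variables (U U' : lmodType k) (f : U -> U') (hf : linear f).
#[local] HB.instance Definition _ := GRing.isLinear.Build k U U' _ f hf.
Definition linear_of : {linear U -> U'} := f.
End LinearOf.

Section Theory.
Variables V W : lmodType k.
Implicit Types (v : V) (w : W) (x y t : tensor V W).

(* tens_bilinear, sweedler_tens, sweedler_linear and tensorE amount to the universal
   property of the tensor product: a bilinear b factors uniquely
   through tens, the factorization being t |-> sweedler t b. *)
Lemma sweedler_tens (U : lmodType k) (b : V -> W -> U) v w :
  bilinear_map b -> sweedler (v ⊗ w) b = b v w.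
Proof. by move=> hb; rewrite sweedler_pi // /tsum big_seq1. Qed.

Lemma sweedler_linear (U : lmodType k) (b : V -> W -> U) :
  bilinear_map b -> linear (fun t => sweedler t b).
Proof. by move=> hb c x y; rewrite sweedlerD_ // sweedlerZ_. Qed.

Lemma tens_bilinear : bilinear_map (@tens V W).
Proof.
split=> [w c v1 v2|v c w1 w2]; apply: tensor_sepP => U b hb;
  rewrite sweedler_linear // !sweedler_tens //.
- by case: hb => hb _; rewrite hb.
- by case: hb => _ hb; rewrite hb.
Qed.

Lemma tensPl c v1 v2 w : (c *: v1 + v2) ⊗ w = c *: (v1 ⊗ w) + v2 ⊗ w.
Proof. by case: tens_bilinear => h _; rewrite h. Qed.

Lemma tensPr c v w1 w2 : v ⊗ (c *: w1 + w2) = c *: (v ⊗ w1) + v ⊗ w2.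
Proof. by case: tens_bilinear => _ h; rewrite h. Qed.

Lemma tensZl c v w : (c *: v) ⊗ w = c *: (v ⊗ w).
Proof. by case: tens_bilinear => h _; rewrite (GRing.scalable_linear (h w)). Qed.

Lemma tensZr c v w : v ⊗ (c *: w) = c *: (v ⊗ w).
Proof. by case: tens_bilinear => _ h; rewrite (GRing.scalable_linear (h v)). Qed.

Lemma eq_sweedler (U : lmodType k) (b b' : V -> W -> U) t :
  (forall v w, b v w = b' v w) -> sweedler t b = sweedler t b'.
Proof. by move=> h; apply: eq_bigr => p _; apply: h. Qed.

Lemma linear_sweedler (U U' : lmodType k) (f : {linear U -> U'})
    (b : V -> W -> U) t :
  f (sweedler t b) = sweedler t (fun v w => f (b v w)).
Proof. by rewrite /sweedler /tsum linear_sum. Qed.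

Lemma tensorE t : t = sweedler t (@tens V W).
Proof.
apply: tensor_sepP => U b hb.
rewrite -[sweedler (sweedler t _) b]/(linear_of (sweedler_linear hb) _).
rewrite linear_sweedler; congr (sweedler t _).
by apply/funext => v; apply/funext => w; rewrite /= sweedler_tens.
Qed.

End Theory.
End Tensor.

Arguments tensor {k} V W.

Notation "x ⊗ y" := (tens x y) : ring_scope.
(* Sweedler's notation: \sw_(x, y <- t) E is the sum of the E(v_i, w_i) when
   t = v_1 ⊗ w_1 + ... + v_n ⊗ w_n. It only makes sense when E is bilinear in (x, y). *)
Notation "\sw_ ( x , y <- t ) E" := (sweedler t (fun x y => E)) : ring_scope.

HB.mixin Record isHopfAlgebra (k : fieldType) A of GRing.Algebra k A := {
  comul : {linear A -> tensor A A};
  counit : {lrmorphism A -> k^o};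
  antipode : {linear A -> A};
  comulA : forall a : A,
    \sw_(x, a3 <- comul a) \sw_(a1, a2 <- comul x) a1 ⊗ (a2 ⊗ a3) =
    \sw_(a1, x <- comul a) a1 ⊗ comul x;
  comul_counitl : forall a : A, \sw_(a1, a2 <- comul a) counit a1 *: a2 = a;
  comul_counitr : forall a : A, \sw_(a1, a2 <- comul a) counit a2 *: a1 = a;
  comul1 : comul 1 = 1 ⊗ 1;
  comulM : forall a b : A, comul (a * b) =
    \sw_(a1, a2 <- comul a) \sw_(b1, b2 <- comul b) (a1 * b1) ⊗ (a2 * b2);
  antipodel : forall a : A,
    \sw_(a1, a2 <- comul a) antipode a1 * a2 = counit a *: 1;
  antipoder : forall a : A,
    \sw_(a1, a2 <- comul a) a1 * antipode a2 = counit a *: 1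
}.

#[short(type="hopfAlgType")]
HB.structure Definition HopfAlgebra (k : fieldType) :=
  { A of GRing.Algebra k A & isHopfAlgebra k A }.

Section Comodules.
Variables (k : fieldType) (A : hopfAlgType k).

Record comodule := Comodule {
  comodule_sort :> lmodType k;
  coact : {linear comodule_sort -> tensor comodule_sort A};
  coactA : forall v,
    \sw_(x, v2 <- coact v) \sw_(v0, v1 <- coact x) v0 ⊗ (v1 ⊗ v2) =
    \sw_(v0, x <- coact v) v0 ⊗ comul x;
  coact_counit : forall v, \sw_(v0, v1 <- coact v) counit v1 *: v0 = v
}.

Arguments coact {c}.

Definition subcomodule (V : comodule) (W : V -> Prop) : Prop :=
  [/\ W 0,
      forall (c : k) u v, W u -> W v -> W (c *: u + v) &
      forall v, W v -> exists s : seq (V * A),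
        (forall p, p \in s -> W p.1) /\
        coact v = \sum_(p <- s) p.1 ⊗ p.2].

Definition simple_subcomodule (V : comodule) (W : V -> Prop) : Prop :=
  [/\ subcomodule W,
      exists2 v, W v & v <> 0 &
      forall W' : V -> Prop, subcomodule W' -> (forall v, W' v -> W v) ->
        (forall v, W' v -> v = 0) \/ (forall v, W v -> W' v)].

(* V is the sum of its simple subcomodules. *)
Definition semisimple_comodule (V : comodule) : Prop :=
  forall v : V, exists s : seq V,
    v = \sum_(u <- s) u /\
    forall u, u \in s -> exists2 W, simple_subcomodule W & W u.

Definition cosemisimple : Prop := forall V : comodule, semisimple_comodule V.

End Comodules.

Inductive enat := Fin of nat | Infty.

Definition enat_min (P : nat -> Prop) : enat :=
  match pselect (exists n, `[< P n >]) with
  | left h => Fin (ex_minn h)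
  | right _ => Infty
  end.

(* Maximum of a nonempty set of natural numbers, Infty if it is unbounded; the set
   used below contains 0, since Hom(k, k) is nonzero. *)
Definition enat_max (P : nat -> Prop) : enat :=
  enat_min (fun m => forall n, P n -> (n <= m)%N).

Arguments coact {k A c}.

Section YetterDrinfeld.
Variables (k : fieldType) (A : hopfAlgType k).

Record ydmodule := YDModule {
  yd_comodule :> comodule A;
  yd_act : yd_comodule -> A -> yd_comodule;
  yd_act_bilinear : bilinear_map yd_act;
  yd_act1 : forall v, yd_act v 1 = v;
  yd_actM : forall v a b, yd_act v (a * b) = yd_act (yd_act v a) b;
  yd_compat : forall v a,
    coact (yd_act v a) =
    \sw_(x, a3 <- comul a) \sw_(a1, a2 <- comul x) \sw_(v0, v1 <- coact v)
      yd_act v0 a2 ⊗ (antipode a1 * v1 * a3)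
}.

Record ydhom (V W : ydmodule) := YDHom {
  ydhom_fun :> {linear V -> W};
  ydhom_act : forall v a, ydhom_fun (yd_act v a) = yd_act (ydhom_fun v) a;
  ydhom_coact : forall v,
    coact (ydhom_fun v) = \sw_(v0, v1 <- coact v) ydhom_fun v0 ⊗ v1
}.

(* Monomorphisms of Yetter-Drinfeld modules are the injective ones, kernels being
   computed on the underlying vector spaces. *)
Definition yd_injective (I : ydmodule) : Prop :=
  forall (X Y : ydmodule) (i : ydhom X Y) (f : ydhom X I),
    injective i -> exists g : ydhom Y I, forall x, g (i x) = f x.

Record yd_injective_resolution (V : ydmodule) := YDInjectiveResolution {
  ires_obj : nat -> ydmodule;
  ires_aug : ydhom V (ires_obj 0);
  ires_d : forall n, ydhom (ires_obj n) (ires_obj n.+1);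
  ires_injective : forall n, yd_injective (ires_obj n);
  ires_aug_inj : injective ires_aug;
  ires_exact0 : forall x, ires_d 0 x = 0 <-> exists v, x = ires_aug v;
  ires_exactS : forall n x,
    ires_d n.+1 x = 0 <-> exists y, x = ires_d n y
}.

Definition ires_cocycle (X V : ydmodule) (I : yd_injective_resolution V) n
    (f : ydhom X (ires_obj I n)) : Prop :=
  forall x, ires_d I n (f x) = 0.

Definition ires_coboundary (X V : ydmodule) (I : yd_injective_resolution V) n :
    ydhom X (ires_obj I n) -> Prop :=
  match n with
  | 0 => fun f => forall x, f x = 0
  | m.+1 => fun f => exists g : ydhom X (ires_obj I m),
                       forall x, f x = ires_d I m (g x)
  end.

(* Ext^n(X, V), the n-th cohomology of Hom(X, I) for an injective resolution I of V,
   is nonzero. *)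
Definition yd_Ext_neq0 (n : nat) (X V : ydmodule) : Prop :=
  exists (I : yd_injective_resolution V) (f : ydhom X (ires_obj I n)),
    ires_cocycle f /\ ~ ires_coboundary f.

(* The ground field with x . a = counit(a) x and x |-> x ⊗ 1. *)
Section Trivial.

Definition triv_coact : {linear k^o -> tensor k^o A} :=
  linear_of ((tens_bilinear k^o A).1 1).

Definition triv_act (x : k^o) (a : A) : k^o := counit a *: x.

Lemma triv_coactA x :
  \sw_(y, v2 <- triv_coact x) \sw_(v0, v1 <- triv_coact y) v0 ⊗ (v1 ⊗ v2) =
  \sw_(v0, y <- triv_coact x) v0 ⊗ comul y.
Proof.
rewrite /= [LHS](eq_sweedler (b' := fun y v2 => y ⊗ (1 ⊗ v2))); last first.
  move=> y v2; rewrite sweedler_tens //.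
  by split=> [a c u v|u c a b] /=; rewrite ?tensPl ?tensPr.
rewrite !sweedler_tens ?comul1 //.
- by split=> [a c u v|u c a b] /=; rewrite ?tensPl ?linearP ?tensPr.
- by split=> [a c u v|u c a b] /=; rewrite ?tensPl ?tensPr.
Qed.

Lemma triv_coact_counit x : \sw_(v0, v1 <- triv_coact x) counit v1 *: v0 = x.
Proof.
rewrite /= sweedler_tens ?rmorph1 ?scale1r //.
split=> [a c u v|u c v w] /=; first by rewrite scalerDr !scalerA mulrC.
by rewrite linearP scalerDl scalerA.
Qed.

Definition triv_comodule : comodule A :=
  @Comodule k A k^o triv_coact triv_coactA triv_coact_counit.

Lemma triv_act_bilinear : @bilinear_map k triv_comodule A triv_comodule triv_act.
Proof.
split=> [a c u v|u c a b]; rewrite /triv_act; first by rewrite scalerDr !scalerA mulrC.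
by rewrite linearP scalerDl scalerA.
Qed.

Lemma triv_act1 x : triv_act x 1 = x.
Proof. by rewrite /triv_act rmorph1 scale1r. Qed.

Lemma triv_actM x a b : triv_act x (a * b) = triv_act (triv_act x a) b.
Proof. by rewrite /triv_act rmorphM scalerA mulrC. Qed.

Lemma triv_compat x a :
  triv_coact (triv_act x a) =
  \sw_(y, a3 <- comul a) \sw_(a1, a2 <- comul y) \sw_(v0, v1 <- triv_coact x)
    triv_act v0 a2 ⊗ (antipode a1 * v1 * a3).
Proof.
have linS (a3 : A) : linear (fun y : A => x ⊗ (antipode y * a3)).
  by move=> c u v; rewrite linearP mulrDl -scalerAl tensPr.
rewrite [RHS](eq_sweedler (b' := fun y a3 => x ⊗ (antipode y * a3))); last first.
  move=> y a3; rewrite -[RHS]/(linear_of (linS a3) y) -{2}(comul_counitr y).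
  rewrite linear_sweedler; apply: eq_sweedler => a1 a2 /=.
  rewrite sweedler_tens; last first.
    split=> [b c u v|u c b d] /=; rewrite /triv_act.
      by rewrite scalerDr scalerA mulrC -scalerA tensPl.
    by rewrite mulrDr mulrDl -scalerAr -scalerAl tensPr.
  by rewrite mulr1 /triv_act tensZl linearZ /= -scalerAl tensZr.
rewrite -(linear_sweedler (linear_of ((tens_bilinear _ _).2 x))) antipodel.
by rewrite /= tensZr /triv_act tensZl.
Qed.

Definition yd_triv : ydmodule :=
  @YDModule triv_comodule triv_act triv_act_bilinear triv_act1 triv_actM triv_compat.

End Trivial.

Definition cdGS : enat := enat_max (fun n => exists V, yd_Ext_neq0 n yd_triv V).

End YetterDrinfeld.

Section Bimodules.
Variables (k : fieldType) (A : algType k).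

Record bimodule := Bimodule {
  bimod_sort :> lmodType k;
  lact : A -> bimod_sort -> bimod_sort;
  ract : bimod_sort -> A -> bimod_sort;
  lact_bilinear : bilinear_map lact;
  ract_bilinear : bilinear_map ract;
  lact1 : forall m, lact 1 m = m;
  ract1 : forall m, ract m 1 = m;
  lactM : forall a b m, lact (a * b) m = lact a (lact b m);
  ractM : forall m a b, ract m (a * b) = ract (ract m a) b;
  lractA : forall a m b, ract (lact a m) b = lact a (ract m b)
}.

Record bimodhom (M N : bimodule) := BimodHom {
  bimodhom_fun :> {linear M -> N};
  bimodhom_lact : forall a m, bimodhom_fun (lact a m) = lact a (bimodhom_fun m);
  bimodhom_ract : forall m a, bimodhom_fun (ract m a) = ract (bimodhom_fun m) a
}.

Definition bimod_projective (P : bimodule) : Prop :=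
  forall (X Y : bimodule) (p : bimodhom X Y) (f : bimodhom P Y),
    (forall y, exists x, p x = y) -> exists g : bimodhom P X, forall x, p (g x) = f x.

Record bimod_projective_resolution (M : bimodule) := BimodProjectiveResolution {
  pres_obj : nat -> bimodule;
  pres_aug : bimodhom (pres_obj 0) M;
  pres_d : forall n, bimodhom (pres_obj n.+1) (pres_obj n);
  pres_projective : forall n, bimod_projective (pres_obj n);
  pres_aug_surj : forall m, exists x, pres_aug x = m;
  pres_exact0 : forall x, pres_aug x = 0 <-> exists y, x = pres_d 0 y;
  pres_exactS : forall n x, pres_d n x = 0 <-> exists y, x = pres_d n.+1 y
}.

Definition bimod_pdim (M : bimodule) : enat :=
  enat_min (fun n => exists P : bimod_projective_resolution M,
    forall m, (n < m)%N -> forall x : pres_obj P m, x = 0).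

Lemma mul_bilinear : @bilinear_map k A A A *%R.
Proof.
by split=> [b c a a'|a c b b']; rewrite ?mulrDl ?mulrDr -?scalerAl -?scalerAr.
Qed.

Definition regular_bimodule : bimodule :=
  @Bimodule A *%R *%R mul_bilinear mul_bilinear
    (@mul1r A) (@mulr1 A)
    (fun a b m => esym (mulrA a b m)) (fun m a b => mulrA m a b)
    (fun a m b => esym (mulrA a m b)).

Definition cd : enat := bimod_pdim regular_bimodule.

End Bimodules.

(* Main.v *)
(* Let h be the Haar functional of A and let V ⊠ A be the free Yetter-Drinfeld module on
   a comodule V. Averaging with h makes V ⊠ A projective, and the iterated kernels
   K_0 = k, K_(n+1) = ker (K_n ⊠ A -> K_n) compute Ext^(n+1)(k, V) as the maps K_(n+1) -> V
   modulo those extending to K_n ⊠ A.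

   If Ext^(n+1)(k, -) = 0, then K_n ⊠ A -> K_n splits, and applying the exact functor
   X |-> A ⊗ X, which sends k to A and X ⊠ A to a free bimodule, yields a projective
   resolution of A of length n. Conversely, if A has a projective resolution of length
   at most n, then K_(n+1) is an A-linear direct summand of K_n ⊠ A. When moreover
   K_(n+1) is projective, hence a summand of K_(n+1) ⊠ A, the A-linear retraction can be
   averaged into a Yetter-Drinfeld one by means of
     (v ⊗ c) ⊗ b |-> v_0 ⊗ c_2 h(v_1 c_3 S(b) S^3(c_1)),
   so that Ext^(n+1)(k, -) = 0. *)

(* The obstacle is that an A-linear map cannot simply be averaged. The usual average of g has weight
   h(g(v_0)_1 S(v_1)); acting by a leads to weights h(S(a_2) x S^2(a_1)), which would collapse if
   h(xy) = h(y S^2(x)), a property that h need not have. A free target V ⊠ A leaves room for a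
   repair: its coaction sends v ⊗ c to (v_0 ⊗ c_2) ⊗ S(c_1) v_1 c_3, so the naive weight is h(S(c_1)
   v_1 c_3 S(b)), and the displayed formula carries the factor S(c_1) to the right end as
   S^2(S(c_1)). A-linearity then follows from antipode cancellations alone, and the invariance of h
   is left to give colinearity. Hence the retraction of K_n ⊠ A onto K_(n+1) is pushed into K_(n+1)
   ⊠ A before averaging and brought back afterwards, which requires K_(n+1) to be a summand of that
   free module. Finiteness of the Gerstenhaber-Schack dimension supplies this in the top degree. *)
From HB Require Import structures.
Require Import Defs.
From mathcomp Require Import all_boot all_order all_algebra.
From mathcomp Require Import boolp classical_sets functions.

Set Implicit Arguments.
Unset Strict Implicit.
Unset Printing Implicit Defensive.

Import GRing.Theory.
Local Open Scope ring_scope.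

(** * Sweedler calculus *)


Section Linear.
Context {k : fieldType}.
Implicit Types U V W X : lmodType k.

Lemma bilinear_mapI {V W U} (b : V -> W -> U) :
  (forall w, linear (fun v => b v w)) -> (forall v, linear (fun w => b v w)) ->
  bilinear_map b.
Proof. by split. Qed.

Lemma linear_id {V} : linear (fun x : V => x).
Proof. by []. Qed.

Lemma linear_comp {X V W} (f : {linear V -> W}) (g : X -> V) :
  linear g -> linear (fun x => f (g x)).
Proof. by move=> hg c x y; rewrite hg linearP. Qed.

Lemma linearZ_of {V W} (f : V -> W) c v : linear f -> f (c *: v) = c *: f v.
Proof. by move=> hf; rewrite (GRing.scalable_linear hf). Qed.

Lemma linear0_of {V W} (f : V -> W) : linear f -> f 0 = 0.
Proof. by move=> hf; exact: (linear0 (linear_of hf)). Qed.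

Lemma linear_cmp {X V W} (f : V -> W) (g : X -> V) :
  linear f -> linear g -> linear (fun x => f (g x)).
Proof. by move=> hf hg c x y; rewrite hg hf. Qed.

Lemma linear_bill {X V W U} (b : V -> W -> U) (f : X -> V) w :
  bilinear_map b -> linear f -> linear (fun x => b (f x) w).
Proof. by move=> [hb _] hf c x y; rewrite hf (hb w). Qed.

Lemma linear_bilr {X V W U} (b : V -> W -> U) (f : X -> W) v :
  bilinear_map b -> linear f -> linear (fun x => b v (f x)).
Proof. by move=> [_ hb] hf c x y; rewrite hf (hb v). Qed.

Lemma scale_bilinear V : bilinear_map (fun (c : k^o) (v : V) => (c : k) *: v).
Proof.
split=> [v a c d|c a v w]; first by rewrite scalerDl scalerA.
by rewrite scalerDr !scalerA mulrC.
Qed.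

Lemma linear_add {X V} (f g : X -> V) :
  linear f -> linear g -> linear (fun x => f x + g x).
Proof. by move=> hf hg c x y; rewrite hf hg scalerDr addrACA. Qed.

Lemma linear_opp {X V} (f : X -> V) : linear f -> linear (fun x => - f x).
Proof. by move=> hf c x y; rewrite hf opprD scalerN. Qed.

Lemma linear_sw_body {X V W U} (t : tensor V W) (E : X -> V -> W -> U) :
  (forall v w, linear (fun x => E x v w)) ->
  linear (fun x => \sw_(v, w <- t) E x v w).
Proof.
move=> hE c x y; rewrite /sweedler /tsum scaler_sumr -big_split /=.
by apply: eq_bigr => p _; rewrite hE.
Qed.

Lemma linear_sw_arg {X V W U} (T : X -> tensor V W) (b : V -> W -> U) :
  linear T -> bilinear_map b -> linear (fun x => sweedler (T x) b).
Proof. by move=> hT hb c x y; rewrite hT sweedler_linear. Qed.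

Lemma sw_push {V W U U'} (f : U -> U') (E : V -> W -> U) t :
  linear f -> f (sweedler t E) = \sw_(v, w <- t) f (E v w).
Proof. by move=> hf; rewrite -[f]/(linear_of hf : _ -> _) linear_sweedler. Qed.

Lemma sw_scale {V W U} (c : k) (E : V -> W -> U) t :
  c *: sweedler t E = \sw_(v, w <- t) c *: E v w.
Proof. exact: scaler_sumr. Qed.

Lemma sw_sw {V W V' W' U} (t : tensor V W) (E : V -> W -> tensor V' W')
    (b : V' -> W' -> U) :
  bilinear_map b ->
  sweedler (sweedler t E) b = \sw_(v, w <- t) sweedler (E v w) b.
Proof. by move=> hb; apply: (sw_push _ _ (sweedler_linear hb)). Qed.

(** [sweedler] is a finite sum over the chosen representative of the tensor, so this is the exchange
    of two finite sums. *)
Lemma sw_exchange {V W V' W' U} (t : tensor V W) (s : tensor V' W')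
    (E : V -> W -> V' -> W' -> U) :
  \sw_(x, y <- t) \sw_(u, v <- s) E x y u v =
  \sw_(u, v <- s) \sw_(x, y <- t) E x y u v.
Proof. exact: exchange_big. Qed.

Lemma tensBl {V W} (u v : V) (w : W) : (u - v) ⊗ w = u ⊗ w - v ⊗ w.
Proof. by rewrite addrC -scaleN1r tensPl scaleN1r addrC. Qed.

Lemma tensor_ext {V W U} (f g : tensor V W -> U) :
  linear f -> linear g -> (forall v w, f (v ⊗ w) = g (v ⊗ w)) -> f =1 g.
Proof.
move=> hf hg h t; rewrite [t]tensorE !sw_push //.
by apply: eq_sweedler => v w; apply: h.
Qed.

End Linear.

(** Rewriting inside Sweedler sums is legitimate only for multilinear summands, so nearly every step
    leaves such a side goal. The tactic follows the syntax of the summand down to the bound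
    variable. *)
Ltac lin :=
  intros; cbv beta;
  lazymatch goal with
  | |- bilinear_map _ => apply: bilinear_mapI; lin
  | |- linear _ =>
    match goal with
    | |- linear (fun x => x) => exact: linear_id
    | H : linear ?f |- linear ?f => exact: H
    | |- linear ?f =>
        lazymatch f with (fun _ => _) => fail | _ => idtac end;
        change (linear (fun x => f x)); lin
    | |- linear (fun x => (@?f x) ⊗ ?w) =>
        apply: (linear_bill w (tens_bilinear _ _)); lin
    | |- linear (fun x => ?v ⊗ (@?f x)) =>
        apply: (linear_bilr v (tens_bilinear _ _)); lin
    | |- linear (fun x => (@?f x) * ?w) =>
        apply: (linear_bill w (@mul_bilinear _ _)); lin
    | |- linear (fun x => ?v * (@?f x)) =>
        apply: (linear_bilr v (@mul_bilinear _ _)); lin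
    | |- linear (fun x => yd_act (@?f x) ?w) =>
        apply: (linear_bill w (@yd_act_bilinear _ _ _)); lin
    | |- linear (fun x => yd_act ?v (@?f x)) =>
        apply: (linear_bilr v (@yd_act_bilinear _ _ _)); lin
    | |- linear (fun x => lact (@?f x) ?w) =>
        apply: (linear_bill w (@lact_bilinear _ _ _)); lin
    | |- linear (fun x => lact ?v (@?f x)) =>
        apply: (linear_bilr v (@lact_bilinear _ _ _)); lin
    | |- linear (fun x => ract (@?f x) ?w) =>
        apply: (linear_bill w (@ract_bilinear _ _ _)); lin
    | |- linear (fun x => ract ?v (@?f x)) =>
        apply: (linear_bilr v (@ract_bilinear _ _ _)); lin
    | |- linear (fun x => (@?f x) *: ?w) =>
        apply: (linear_bill w (scale_bilinear _)); lin
    | |- linear (fun x => ?v *: (@?f x)) =>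
        apply: (linear_bilr v (scale_bilinear _)); lin
    | |- linear (fun x => (@?f x) + (@?g x)) => apply: linear_add; lin
    | |- linear (fun x => - (@?f x)) => apply: linear_opp; lin
    | |- linear (fun x => GRing.Linear.sort ?f (@?g x)) =>
        apply: (linear_comp f); lin
    | |- linear (fun x => GRing.LRMorphism.sort ?f (@?g x)) =>
        apply: (linear_comp f); lin
    | |- linear (fun x => sweedler ?t (@?E x)) => apply: linear_sw_body; lin
    | |- linear (fun x => sweedler (@?T x) ?b) => apply: linear_sw_arg; lin
    | H : bilinear_map ?b |- linear (fun x => ?b (@?f x) ?w) =>
        apply: (linear_bill w H); lin
    | H : bilinear_map ?b |- linear (fun x => ?b ?v (@?f x)) =>
        apply: (linear_bilr v H); lin
    | H : forall y z, linear (fun x => ?f x y z) |- linear (fun x => ?f (@?g x) ?y ?z) =>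
        apply: (linear_cmp (H y z)); lin
    | H : forall x z, linear (fun y => ?f x y z) |- linear (fun y => ?f ?x (@?g y) ?z) =>
        apply: (linear_cmp (H x z)); lin
    | H : forall x y, linear (fun z => ?f x y z) |- linear (fun z => ?f ?x ?y (@?g z)) =>
        apply: (linear_cmp (H x y)); lin
    | H : linear ?f |- linear (fun x => ?f (@?g x)) => apply: (linear_cmp H); lin
    end
  end.

Section Coalgebra.
Variables (k : fieldType) (A : hopfAlgType k).
Implicit Types (a b : A) (U : lmodType k).

(** [comulA] is an equality in A ⊗ (A ⊗ A); applying the linear map induced there by a trilinear [f]
    gives the usual license to renumber legs. *)
Lemma coassoc U (f : A -> A -> A -> U) a :
  (forall y z, linear (fun x => f x y z)) ->
  (forall x z, linear (fun y => f x y z)) ->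
  (forall x y, linear (fun z => f x y z)) ->
  \sw_(x, a3 <- comul a) \sw_(a1, a2 <- comul x) f a1 a2 a3 =
  \sw_(a1, x <- comul a) \sw_(a2, a3 <- comul x) f a1 a2 a3.
Proof.
move=> h1 h2 h3.
pose g (t : tensor A (tensor A A)) := \sw_(x, y <- t) \sw_(a2, a3 <- y) f x a2 a3.
have hg : linear g by rewrite /g; lin.
have := congr1 g (comulA a); rewrite !(sw_push _ _ hg) => e.
transitivity (\sw_(x, y <- comul a) g (\sw_(a1, a2 <- comul x) (a1 ⊗ (a2 ⊗ y)))).
  apply: eq_sweedler => x y; rewrite (sw_push _ _ hg); apply: eq_sweedler => u v.
  by rewrite /g !sweedler_tens //; lin.
by rewrite e; apply: eq_sweedler => x y; rewrite /g sweedler_tens //; lin.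
Qed.

Lemma coact_coassoc (V : comodule A) U (f : V -> A -> A -> U) v :
  (forall y z, linear (fun x => f x y z)) ->
  (forall x z, linear (fun y => f x y z)) ->
  (forall x y, linear (fun z => f x y z)) ->
  \sw_(x, a3 <- coact v) \sw_(a1, a2 <- coact x) f a1 a2 a3 =
  \sw_(a1, x <- coact v) \sw_(a2, a3 <- comul x) f a1 a2 a3.
Proof.
move=> h1 h2 h3.
pose g (t : tensor V (tensor A A)) := \sw_(x, y <- t) \sw_(a2, a3 <- y) f x a2 a3.
have hg : linear g by rewrite /g; lin.
have := congr1 g (coactA v); rewrite !(sw_push _ _ hg) => e.
transitivity (\sw_(x, y <- coact v) g (\sw_(a1, a2 <- coact x) (a1 ⊗ (a2 ⊗ y)))).
  apply: eq_sweedler => x y; rewrite (sw_push _ _ hg); apply: eq_sweedler => u w.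
  by rewrite /g !sweedler_tens //; lin.
by rewrite e; apply: eq_sweedler => x y; rewrite /g sweedler_tens //; lin.
Qed.

Lemma sw_counitl U (f : A -> U) a :
  linear f -> \sw_(a1, a2 <- comul a) counit a1 *: f a2 = f a.
Proof.
move=> hf; rewrite -{2}(comul_counitl a) (sw_push _ _ hf).
by apply: eq_sweedler => x y; rewrite (linearZ_of _ _ hf).
Qed.

Lemma sw_counitr U (f : A -> U) a :
  linear f -> \sw_(a1, a2 <- comul a) counit a2 *: f a1 = f a.
Proof.
move=> hf; rewrite -{2}(comul_counitr a) (sw_push _ _ hf).
by apply: eq_sweedler => x y; rewrite (linearZ_of _ _ hf).
Qed.

Lemma sw_coact_counit (V : comodule A) U (f : V -> U) v :
  linear f -> \sw_(v0, v1 <- coact v) counit v1 *: f v0 = f v.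
Proof.
move=> hf; rewrite -{2}(coact_counit v) (sw_push _ _ hf).
by apply: eq_sweedler => x y; rewrite (linearZ_of _ _ hf).
Qed.

Lemma sw_comulM U (b : A -> A -> U) x y : bilinear_map b ->
  sweedler (comul (x * y)) b =
  \sw_(x1, x2 <- comul x) \sw_(y1, y2 <- comul y) b (x1 * y1) (x2 * y2).
Proof.
move=> hb; rewrite comulM sw_sw //; apply: eq_sweedler => x1 x2.
rewrite sw_sw //; apply: eq_sweedler => y1 y2.
by rewrite sweedler_tens.
Qed.

Lemma sw_comul1 U (b : A -> A -> U) : bilinear_map b ->
  sweedler (comul 1) b = b 1 1.
Proof. by move=> hb; rewrite comul1 sweedler_tens. Qed.

Lemma sw_antipodel U (f : A -> U) a : linear f ->
  \sw_(a1, a2 <- comul a) f (antipode a1 * a2) = counit a *: f 1.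
Proof. by move=> hf; rewrite -(sw_push _ _ hf) antipodel (linearZ_of _ _ hf). Qed.

Lemma sw_antipoder U (f : A -> U) a : linear f ->
  \sw_(a1, a2 <- comul a) f (a1 * antipode a2) = counit a *: f 1.
Proof. by move=> hf; rewrite -(sw_push _ _ hf) antipoder (linearZ_of _ _ hf). Qed.

End Coalgebra.

(** * The antipode *)


(** The rewritten summand is not written out: it instantiates the middle term left open by
    [etransitivity]. *)
Ltac under_sw tac :=
  etransitivity;
  [ apply: eq_sweedler => ? ?; tac; reflexivity | cbv beta ].

Section Antipode.
Variables (k : fieldType) (A : hopfAlgType k).
Implicit Types (a b : A) (U : lmodType k).

Lemma sw_antipodelK U (f : A -> A -> U) a : bilinear_map f ->
  \sw_(a1, x <- comul a) \sw_(a2, a3 <- comul x) f (antipode a1 * a2) a3 = f 1 a.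
Proof.
move=> hf; rewrite -coassoc; try lin.
under_sw ltac:(rewrite (sw_antipodel (f := fun u => f u _)); try lin).
by rewrite sw_counitl; try lin.
Qed.

Lemma sw_antipoderK U (f : A -> A -> U) a : bilinear_map f ->
  \sw_(a1, x <- comul a) \sw_(a2, a3 <- comul x) f (a1 * antipode a2) a3 = f 1 a.
Proof.
move=> hf; rewrite -coassoc; try lin.
under_sw ltac:(rewrite (sw_antipoder (f := fun u => f u _)); try lin).
by rewrite sw_counitl; try lin.
Qed.

(** The middle term is Δ(S(a_1)) (a_2 S(a_5) ⊗ a_3 S(a_4)). Collapsing a_3 S(a_4) and then a_2
    S(a_5) leaves Δ(S(a)); grouping Δ(S(a_1)) Δ(a_2) as Δ(S(a_1) a_2) instead leaves S(a_2) ⊗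
    S(a_1). *)
Lemma sw_comul_antipode U (f : A -> A -> U) a : bilinear_map f ->
  sweedler (comul (antipode a)) f =
  \sw_(a1, a2 <- comul a) f (antipode a2) (antipode a1).
Proof.
move=> hf.
transitivity (\sw_(a1, x <- comul a) \sw_(a2, y <- comul x)
  \sw_(a3, z <- comul y) \sw_(a4, a5 <- comul z) \sw_(u, v <- comul (antipode a1))
    f (u * a2 * antipode a5) (v * a3 * antipode a4)).
  symmetry.
  under_sw ltac:(under_sw ltac:(
   under_sw ltac:(under_sw ltac:(under_sw ltac:(rewrite -(mulrA _ _ (antipode _)) -(mulrA _ _ (antipode _)))));
   rewrite (sw_antipoderK (f := fun p q =>
   \sw_(u, v <- comul (antipode _)) f (u * (_ * antipode q)) (v * p))); try lin)).
  under_sw ltac:(rewrite (sw_antipoder (f := fun p => 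
   \sw_(u, v <- comul (antipode _)) f (u * p) (v * 1))); try lin).
  rewrite sw_counitr; try lin.
  by apply: eq_sweedler => u v; rewrite !mulr1.
under_sw ltac:(rewrite -coassoc; try lin).
rewrite -coassoc; try lin.
under_sw ltac:(under_sw ltac:(
  under_sw ltac:(rewrite sw_exchange); rewrite sw_exchange;
  rewrite -(sw_comulM (b := fun c1 c2 => \sw_(a4, a5 <- comul _)
     f (c1 * antipode a5) (c2 * antipode a4))); try lin)).
under_sw ltac:(rewrite (sw_antipodel (f := fun c => \sw_(c1, c2 <- comul c) \sw_(a4, a5 <- comul _)
     f (c1 * antipode a5) (c2 * antipode a4))); try lin).
rewrite sw_counitl; try lin.
rewrite sw_comul1; try lin.
by apply: eq_sweedler => x y; rewrite !mul1r.
Qed.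

(** Both sides evaluate S(b_1) S(a_1) a_2 b_2 S(a_3 b_3), collapsed from the left or from the right:
    uniqueness of convolution inverses. *)
Lemma antipodeM a b : antipode (a * b) = antipode b * antipode a.
Proof.
transitivity (\sw_(a1, x <- comul a) \sw_(b1, y <- comul b)
  (antipode b1 * antipode a1 * \sw_(c1, c2 <- comul (x * y)) c1 * antipode c2)).
  symmetry.
  transitivity (\sw_(a1, x <- comul a) \sw_(x1, x2 <- comul x)
    \sw_(b1, y <- comul b) \sw_(y1, y2 <- comul y)
      antipode b1 * ((antipode a1 * x1) * (y1 * antipode (x2 * y2)))).
    apply: eq_sweedler => a1 x; rewrite sw_exchange.
    apply: eq_sweedler => b1 y; rewrite sw_comulM; try lin.
    rewrite (sw_push _ _ (f := fun u => _ * u)); try lin.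
    apply: eq_sweedler => x1 x2.
    rewrite (sw_push _ _ (f := fun u => _ * u)); try lin.
    by apply: eq_sweedler => y1 y2; rewrite !mulrA.
  rewrite (sw_antipodelK (f := fun p q => \sw_(b1, y <- comul b)
    \sw_(y1, y2 <- comul y) antipode b1 * (p * (y1 * antipode (q * y2))))); try lin.
  under_sw ltac:(under_sw ltac:(rewrite mul1r mulrA)).
  by rewrite (sw_antipodelK (f := fun p q => p * antipode (a * q))) ?mul1r; try lin.
under_sw ltac:(under_sw ltac:(rewrite antipoder rmorphM -scalerA -!scalerAr mulr1);
  rewrite -sw_scale;
  rewrite (sw_counitr (f := fun u => antipode u * _)); try lin).
by rewrite (sw_counitr (f := fun u => _ * antipode u)); try lin.
Qed.

Lemma antipode1 : antipode 1 = 1 :> A.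
Proof.
have := antipodel (1 : A); rewrite sw_comul1; try lin.
by rewrite mulr1 rmorph1 scale1r.
Qed.

End Antipode.

(** * Linear algebra over infinite-dimensional spaces, and the Haar functional *)


Section Complement.
Variables (k : fieldType) (X : lmodType k) (I : Type) (T : I -> X -> X).
Hypothesis T_linear : forall i, linear (T i).

(** Serves two families: the operators given by functionals through a coaction, whose stable
    subspaces are the subcomodules, and the empty family, for which every subspace is stable. *)
Definition stable (W : X -> Prop) : Prop :=
  [/\ W 0, forall c u v, W u -> W v -> W (c *: u + v) &
      forall i v, W v -> W (T i v)].

Definition simple_stable (S : X -> Prop) : Prop :=
  stable S /\ forall W, stable W -> (forall v, W v -> S v) ->
    (forall v, W v -> v = 0) \/ (forall v, S v -> W v).

Definition sumP (U V : X -> Prop) (v : X) : Prop :=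
  exists u w, [/\ U u, V w & v = u + w].

Lemma sumP_stable U V : stable U -> stable V -> stable (sumP U V).
Proof.
move=> [U0 UL UT] [V0 VL VT]; split.
- by exists 0, 0; split=> //; rewrite addr0.
- move=> c _ _ [u [v [hu hv ->]]] [u' [v' [hu' hv' ->]]].
  exists (c *: u + u'), (c *: v + v'); split; [exact: UL|exact: VL|].
  by rewrite scalerDr addrACA.
- move=> i _ [u [v [hu hv ->]]]; exists (T i u), (T i v); split; [exact: UT|exact: VT|].
  by have := T_linear i 1 u v; rewrite !scale1r.
Qed.

Lemma stable_opp W v : stable W -> W v -> W (- v).
Proof. by move=> [W0 WL _] hv; have := WL (-1) v 0 hv W0; rewrite addr0 scaleN1r. Qed.

Lemma stable_add W u v : stable W -> W u -> W v -> W (u + v).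
Proof. by move=> [W0 WL _] hu hv; have := WL 1 u v hu hv; rewrite scale1r. Qed.

(** Take [D] maximal among stable subspaces meeting [U] trivially. If U + D missed a vector, it
    would miss a vector of some simple [S]; then S meets U + D trivially, and D + S contradicts
    maximality. *)
Lemma stable_complement (U : X -> Prop) :
  (forall v, exists s : seq X, v = \sum_(u <- s) u /\
     forall u, u \in s -> exists2 S, simple_stable S & S u) ->
  stable U ->
  exists2 D, stable D & (forall v, U v -> D v -> v = 0) /\ forall v, sumP U D v.
Proof.
move=> semis hU.
(* [Zorn_bigcup] also takes the union of the empty chain, which does not contain 0; adjoining 0 by
   hand makes that union acceptable. *)
pose add0 (D : set X) v := v = 0 \/ D v.
pose P (D : set X) := stable (add0 D) /\ forall v, U v -> add0 D v -> v = 0.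
have [D [[hD UD] maxD]] : exists D, P D /\ forall D', (D `<` D')%classic -> ~ P D'.
  apply: Zorn_bigcup => F FP Ftot; split; first split.
  - by left.
  - move=> c u v [->|[D1 FD1 hu]] [->|[D2 FD2 hv]].
    + by left; rewrite scaler0 addr0.
    + by right; exists D2 => //; rewrite scaler0 add0r.
    + have [[D0 DL _] _] := FP _ FD1.
      by case: (DL c u 0 (or_intror hu) D0) => [->|h]; [left|right; exists D1].
    + have [D12|D21] := Ftot _ _ FD1 FD2.
        have [[D0 DL _] _] := FP _ FD2.
        case: (DL c u v (or_intror (D12 _ hu)) (or_intror hv)) => [->|h]; first by left.
        by right; exists D2.
      have [[D0 DL _] _] := FP _ FD1.
      case: (DL c u v (or_intror hu) (or_intror (D21 _ hv))) => [->|h]; first by left.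
      by right; exists D1.
  - move=> i v [->|[D1 FD1 hv]].
      by left; exact: (linear0 (linear_of (T_linear i))).
    have [[D0 _ DT] _] := FP _ FD1.
    by case: (DT i v (or_intror hv)) => [->|h]; [left|right; exists D1].
  - move=> v hv [->//|[D1 FD1 hv1]].
    by have [_ h] := FP _ FD1; apply: h => //; right.
exists (add0 D) => //; split=> // v; apply: contrapT => nv.
have hS := sumP_stable hU hD.
have [s [vs hs]] := semis v.
have [u us nu] : exists2 u, u \in s & ~ sumP U (add0 D) u.
  apply: contrapT => ns; apply: nv; rewrite vs big_seq.
  apply: big_ind => [||u us]; first by case: hS.
    by move=> x y; apply: stable_add.
  by apply: contrapT => nu; apply: ns; exists u.
have [S [Sst Ssimp] Su] := hs u us.
pose C x := S x /\ sumP U (add0 D) x.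
have C0 x : C x -> x = 0.
  have Cst : stable C.
    case: Sst hS => [S0 SL ST] [Q0 QL QT].
    by split=> [|c y z [h1 h2] [h3 h4]|i y [h1 h2]]; split; auto.
  case: (Ssimp C Cst) => [y []//|h|h]; first exact: h.
  by case: nu; case: (h _ Su).
have hD' := sumP_stable hD Sst.
have DD' x : add0 D x -> sumP (add0 D) S x.
  by move=> Dx; exists x, 0; split; rewrite ?addr0 //; case: Sst.
have uD' : sumP (add0 D) S u.
  by exists 0, u; split; rewrite ?add0r //; left.
apply: (maxD (sumP (add0 D) S)).
  split=> [x Dx|h]; first by apply: DD'; right.
  apply: nu; exists 0, u; split; rewrite ?add0r //; first by case: hU.
  by right; apply: h.
have e : add0 (sumP (add0 D) S) = sumP (add0 D) S.
  apply/funext => x; apply/propext; split=> [[->|//]|]; last by right.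
  by case: hD'.
split; rewrite e // => x Ux [d [y [Dd Sy xE]]].
have y0 : y = 0.
  apply: C0; split=> //; exists x, (- d); split=> //; first exact: stable_opp.
  by rewrite xE addrAC subrr add0r.
by rewrite y0 addr0 in xE; apply: UD; rewrite ?xE // -xE.
Qed.

End Complement.

Section LinearAlgebra.
Variables (k : fieldType).
Implicit Types X Y W : lmodType k.

(** With no operators at all, every line is simple, so every vector space is the sum of its simple
    stable subspaces. *)
Lemma subspace_complement X (U : X -> Prop) :
  U 0 -> (forall c u v, U u -> U v -> U (c *: u + v)) ->
  exists D : X -> Prop, [/\ D 0, forall c u v, D u -> D v -> D (c *: u + v),
    forall v, U v -> D v -> v = 0 & forall v, sumP U D v].
Proof.
move=> U0 UL.
have [|v|//|D [D0 DL _] [UD UDs]] := @stable_complement k X False (fun _ => id) _ U.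
- by [].
- exists [:: v]; rewrite big_seq1; split=> // _ /[1!inE] /eqP ->.
  exists (fun x => exists c, x = c *: v); last by exists 1; rewrite scale1r.
  split; first split=> //.
  + by exists 0; rewrite scale0r.
  + by move=> c _ _ [a ->] [b ->]; exists (c * a + b); rewrite scalerDl scalerA.
  + move=> W [W0 WL _] Wv.
    case: (pselect (exists2 w, W w & w <> 0)) => [[w Ww w0]|nW]; last first.
      by left=> w Ww; apply: contrapT => w0; apply: nW; exists w.
    right=> _ [a ->]; have [c wE] := Wv _ Ww.
    have c0 : c != 0 by apply/eqP => c0; apply: w0; rewrite wE c0 scale0r.
    have := WL (a / c) w 0 Ww W0.
    by rewrite addr0 wE scalerA -mulrA mulVf // mulr1.
by exists D.
Qed.

Lemma subspace_proj X (U : X -> Prop) :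
  U 0 -> (forall c u v, U u -> U v -> U (c *: u + v)) ->
  exists p : {linear X -> X}, (forall v, U v -> p v = 0) /\ forall v, U (v - p v).
Proof.
move=> U0 UL; have [D [D0 DL UD UDs]] := subspace_complement U0 UL.
have ex v : exists d, D d /\ U (v - d).
  by have [u [d [Uu Dd ->]]] := UDs v; exists d; rewrite addrK.
have subP (P : X -> Prop) u v : P 0 ->
    (forall c u v, P u -> P v -> P (c *: u + v)) -> P u -> P v -> P (u - v).
  by move=> P0 PL Pu Pv; rewrite addrC -scaleN1r; apply: PL.
have uniq v d d' : D d -> U (v - d) -> D d' -> U (v - d') -> d = d'.
  move=> Dd Ud Dd' Ud'; apply/eqP; rewrite -subr_eq0; apply/eqP.
  apply: UD; last exact: subP.
  by have := subP _ _ _ U0 UL Ud' Ud; rewrite opprB addrC addrA addrNK.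
pose p v := projT1 (cid (ex v)).
have pP v : D (p v) /\ U (v - p v) := projT2 (cid (ex v)).
have plin : linear p.
  move=> c x y; have [Dx Ux] := pP x; have [Dy Uy] := pP y.
  have [Dxy Uxy] := pP (c *: x + y); apply: (uniq _ _ _ Dxy Uxy (DL _ _ _ Dx Dy)).
  by have := UL c _ _ Ux Uy; rewrite scalerBr opprD addrACA.
exists (linear_of plin); split=> [v Uv|v] /=; last by have [] := pP v.
by have [Dv Uv'] := pP v; apply: (uniq v); rewrite ?subr0.
Qed.

(** A generalized inverse is a section of a surjection and a retraction of an injection, so lifting,
    extension and kernels all come from it. To get [s], project [y] to the image of [i], choose a
    preimage and apply [q]; since [q] kills the kernel of [i], the choice does not matter and [s] is
    linear. *)
Lemma linear_ginv X Y (i : {linear X -> Y}) :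
  exists s : {linear Y -> X}, forall x, i (s (i x)) = i x.
Proof.
have [||p [p0 pU]] := @subspace_proj Y (fun y => exists x, y = i x).
- by exists 0; rewrite linear0.
- by move=> c _ _ [x ->] [y ->]; exists (c *: x + y); rewrite linearP.
have [||q [q0 qU]] := @subspace_proj X (fun x => i x = 0).
- by rewrite linear0.
- by move=> c u v hu hv; rewrite linearP hu hv scaler0 addr0.
pose s y := q (projT1 (cid (pU y))).
have sP y x : y - p y = i x -> s y = q x.
  move=> e; rewrite /s; case: cid => z /= ez; apply/eqP; rewrite -subr_eq0 -linearB.
  by apply/eqP/q0; rewrite linearB -ez e subrr.
have slin : linear s.
  move=> c x y; have [u eu] := pU x; have [v ev] := pU y.
  rewrite (sP _ _ eu) (sP _ _ ev) -linearP; apply: sP.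
  by rewrite (linearP p) (linearP i) -eu -ev scalerBr opprD addrACA.
exists (linear_of slin) => x /=.
rewrite (sP _ x); last by rewrite p0 ?subr0 //; exists x.
by apply/eqP; rewrite eq_sym -subr_eq0 -linearB qU.
Qed.

Lemma linear_lift X Y W (f : {linear W -> Y}) (g : {linear X -> Y}) :
  (forall w, exists x, f w = g x) ->
  exists h : {linear W -> X}, forall w, g (h w) = f w.
Proof.
move=> fg; have [s gs] := linear_ginv g.
exists (s \o f) => w /=; by have [x ->] := fg w.
Qed.

Lemma linear_extend X Y W (i : {linear X -> Y}) (f : {linear X -> W}) :
  injective i -> exists h : {linear Y -> W}, forall x, h (i x) = f x.
Proof.
move=> ii; have [s gs] := linear_ginv i.
by exists (f \o s) => x /=; congr (f _); apply: ii.
Qed.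

Lemma linear_ker X Y (i : {linear X -> Y}) :
  exists p : {linear Y -> Y}, forall y, p y = 0 <-> exists x, y = i x.
Proof.
have [s gs] := linear_ginv i.
have lp : linear (fun y => y - i (s y)) by lin.
exists (linear_of lp) => y /=; split=> [/eqP|[x ->]]; last by rewrite gs subrr.
by rewrite subr_eq0 => /eqP ->; exists (s y).
Qed.

Lemma functional_separates X (v : X) : v <> 0 ->
  exists f : {linear X -> k^o}, f v = 1.
Proof.
move=> v0; have lv : linear (fun c : k^o => c *: v) by lin.
have iv : injective (linear_of lv).
  move=> c d /= /eqP; rewrite -subr_eq0 -scalerBl scaler_eq0 => /orP[|/eqP//].
  by rewrite subr_eq0 => /eqP.
have [f hf] := linear_extend (linear_of (@linear_id k k^o)) iv.
by exists f; have := hf 1; rewrite /= scale1r.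
Qed.

Lemma subspace_functional X (U : X -> Prop) v :
  U 0 -> (forall c u v, U u -> U v -> U (c *: u + v)) -> ~ U v ->
  exists f : {linear X -> k^o}, f v = 1 /\ forall u, U u -> f u = 0.
Proof.
move=> U0 UL nUv; have [p [p0 pU]] := subspace_proj U0 UL.
have [|f fv] := @functional_separates X (p v).
  by move=> e; apply: nUv; have := pU v; rewrite e subr0.
exists (f \o p); split=> [//|u Uu] /=.
by rewrite p0 // linear0.
Qed.

(** Induction on the number of terms. If the first [w] is a combination of the others, its term is
    absorbed into them; otherwise a functional that is 1 on it and 0 on the others shows that the
    first [x] is 0. *)
Lemma tensor_functionals X W (t : tensor X W) :
  (forall f : {linear W -> k^o}, \sw_(x, w <- t) (f w : k) *: x = 0) -> t = 0.
Proof.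
have [n [x [w ->]]] : exists n (x : 'I_n -> X) (w : 'I_n -> W), t = \sum_i x i ⊗ w i.
  have -> : t = \sum_(p <- repr t) p.1 ⊗ p.2 := tensorE t.
  exists (size (repr t)), (fun i => (tnth (in_tuple (repr t)) i).1),
    (fun i => (tnth (in_tuple (repr t)) i).2).
  by rewrite -[in LHS](in_tupleE (repr t)) big_tuple.
have fE m (y : 'I_m -> X) (z : 'I_m -> W) (f : {linear W -> k^o}) :
    \sw_(x, w <- \sum_i y i ⊗ z i) (f w : k) *: x = \sum_i (f (z i) : k) *: y i.
  have lb : bilinear_map (fun (x : X) (w : W) => (f w : k) *: x) by lin.
  rewrite -[LHS]/(linear_of (sweedler_linear lb) _) linear_sum.
  by apply: eq_bigr => i _ /=; rewrite sweedler_tens.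
elim: n x w {t} => [|n IH] x w h; first by rewrite big_ord0.
have [[r wr]|nw] := pselect (exists r : 'I_n -> k,
    w ord0 = \sum_i r i *: w (lift ord0 i)).
  have e : \sum_i x i ⊗ w i =
      \sum_i (r i *: x ord0 + x (lift ord0 i)) ⊗ w (lift ord0 i).
    rewrite big_ord_recl wr.
    rewrite -[X in X + _]/(linear_of ((tens_bilinear X W).2 (x ord0)) _) linear_sum.
    rewrite -big_split; apply: eq_bigr => i _ /=.
    by rewrite tensPl tensZr.
  by rewrite e; apply: IH => f; rewrite -e.
have [||f [fw f0]] := subspace_functional (U := fun v : W => exists r : 'I_n -> k,
    v = \sum_i r i *: w (lift ord0 i)) _ _ nw.
- by exists (fun=> 0); rewrite big1 // => i _; rewrite scale0r.
- move=> c _ _ [r ->] [s ->]; exists (fun i => c * r i + s i).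
  rewrite scaler_sumr -big_split; apply: eq_bigr => i _ /=.
  by rewrite scalerDl scalerA.
have f0' i : f (w (lift ord0 i)) = 0.
  apply: f0; exists (fun j => (j == i)%:R).
  rewrite (bigD1 i) //= eqxx scale1r big1 ?addr0 // => j /negbTE ->.
  by rewrite scale0r.
have x0 : x ord0 = 0.
  have := h f; rewrite fE big_ord_recl fw scale1r big1 ?addr0 // => i _.
  by rewrite f0' scale0r.
have e : \sum_i x i ⊗ w i = \sum_i x (lift ord0 i) ⊗ w (lift ord0 i).
  rewrite big_ord_recl x0 -[X in X ⊗ _](scale0r 0) tensZl scale0r add0r //.
by rewrite e; apply: IH => f'; rewrite -e.
Qed.

End LinearAlgebra.

(** * The Haar functional *)

Section Haar.
Variables (k : fieldType) (A : hopfAlgType k).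

Definition regular_comodule : comodule A :=
  @Comodule k A A comul (@comulA k A) (@comul_counitr k A).

Definition coact_by (V : comodule A) (f : {linear A -> k^o}) (v : V) : V :=
  \sw_(v0, v1 <- coact v) (f v1 : k) *: v0.

Lemma coact_by_linear (V : comodule A) f : linear (@coact_by V f).
Proof. by rewrite /coact_by; lin. Qed.

(** For the converse, [p] is linear with kernel [W]. Replacing each left leg q by q - p q puts it in
    [W], and the error, the sum of p(v_0) ⊗ v_1, is 0 because a functional [f] on the right leg
    sends it to p([coact_by] f v). *)
Lemma subcomodule_stable (V : comodule A) (W : V -> Prop) :
  subcomodule W <-> stable (@coact_by V) W.
Proof.
split=> [[W0 WL Wc]|[W0 WL WT]]; split=> //.
  move=> f v /Wc[s [sW e]].
  have lb : bilinear_map (fun (x : V) (a : A) => (f a : k) *: x) by lin.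
  rewrite /coact_by e -[sweedler _ _]/(linear_of (sweedler_linear lb) _) linear_sum /=.
  rewrite big_seq; apply: big_ind => [//|x y hx hy|p ps].
    by have := WL 1 x y hx hy; rewrite scale1r.
  rewrite sweedler_tens; try lin.
  by have := WL (f p.2) p.1 0 (sW p ps) W0; rewrite addr0.
move=> v Wv; have [p [p0 pW]] := subspace_proj W0 WL.
exists [seq (q.1 - p q.1, q.2) | q <- repr (coact v)]; split.
  by move=> _ /mapP[q _ ->] /=.
rewrite big_map /= {1}[coact v]tensorE.
apply/eqP; rewrite -subr_eq0 -sumrB; apply/eqP.
rewrite (eq_bigr (fun q => p q.1 ⊗ q.2)); last first.
  by move=> q _; rewrite tensBl opprB addrC addrNK.
apply: tensor_functionals => f.
rewrite -[\sum_(q <- _) _]/(\sw_(x, a <- coact v) p x ⊗ a) sw_sw; try lin.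
under_sw ltac:(rewrite sweedler_tens; try lin).
under_sw ltac:(rewrite -linearZ_LR).
by rewrite -linear_sweedler; apply/p0/WT.
Qed.

Lemma simple_subcomodule_stable (V : comodule A) (W : V -> Prop) :
  simple_subcomodule W -> simple_stable (@coact_by V) W.
Proof.
move=> [/subcomodule_stable Wst _ Ws]; split=> // W' /subcomodule_stable W'st.
exact: Ws.
Qed.

(* A functional h with h(1) = 1 killing a subcomodule complement of k1 satisfies
   h(a_1) a_2 = h(a) 1; composing with the antipode gives the other invariance. *)
Lemma haar_functional : cosemisimple A ->
  exists h : {linear A -> k^o}, h 1 = 1 /\
    forall a : A, \sw_(a1, a2 <- comul a) (h a2 : k) *: a1 = (h a : k) *: (1 : A).
Proof.
move=> ss; pose V := regular_comodule.
pose e : V := (1 : A).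
pose U (v : V) := exists c : k, v = c *: e.
have cbe f c : coact_by f (c *: e) = (c * (f 1 : k)) *: e.
  rewrite (linearZ_of _ _ (@coact_by_linear V f)) /coact_by sw_comul1; try lin.
  by rewrite scalerA.
have [|v||D [D0 DL DT] [UD UDs]] := @stable_complement k V _ (@coact_by V) _ U.
- exact: coact_by_linear.
- have [s [vs hs]] := ss V v; exists s; split=> // u /hs[W hW Wu].
  by exists W => //; apply: simple_subcomodule_stable.
- split; first by exists 0; rewrite scale0r.
    move=> c _ _ [a ->] [b ->]; exists (c * a + b).
    by rewrite scalerDl scalerA.
  by move=> f _ [a ->]; exists (a * (f 1 : k)); rewrite cbe.
have e0 : e <> 0.
  move=> e0; have := rmorph1 (@counit k A); rewrite -[1 in LHS]/e e0 rmorph0 => /eqP.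
  by rewrite eq_sym oner_eq0.
have nDe : ~ D e.
  by move=> De; apply: e0; apply: UD => //; exists 1; rewrite scale1r.
have [h [h1 hD]] := subspace_functional D0 DL nDe.
have hT f a : h (coact_by f a) = (f 1 : k) * (h a : k).
  have [_ [d [[c ->] Dd ->]]] := UDs a.
  have -> : coact_by f (c *: e + d) = (c * (f 1 : k)) *: e + coact_by f d.
    by rewrite -cbe -[in RHS](scale1r (coact_by f (c *: e))) -(@coact_by_linear V f) scale1r.
  rewrite !linearD (hD _ Dd) (hD _ (DT _ _ Dd)) !addr0 !linearZ_LR h1.
  by rewrite /= -[_ *: _]/(_ * _) -[c *: _]/(_ * _) !mulr1 mulrC.
have hl (a : A) : \sw_(a1, a2 <- comul a) (h a1 : k) *: a2 = (h a : k) *: (1 : A).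
  apply: contrapT => /eqP; rewrite -subr_eq0 => /eqP ne.
  have [f] := functional_separates ne.
  rewrite linearB linear_sweedler linearZ_LR.
  have -> : \sw_(a1, a2 <- comul a) f ((h a1 : k) *: a2) = h (@coact_by V f a).
    rewrite /coact_by linear_sweedler; apply: eq_sweedler => x y.
    by rewrite !linearZ_LR -[LHS]/(_ * _) mulrC.
  by rewrite hT -[_ *: _]/(_ * _) mulrC subrr => /eqP; rewrite eq_sym oner_eq0.
exists (h \o antipode); split=> [|a] /=; first by rewrite antipode1.
have hS a' : \sw_(x, y <- comul a') (h (antipode y) : k) *: antipode x = (h (antipode a') : k) *: (1 : A).
  by rewrite -hl sw_comul_antipode; try lin.
under_sw ltac:(rewrite -[X in _ *: X](mulr1) scalerAr -hS).
under_sw ltac:(rewrite (sw_push _ _ (f := fun u => _ * u)); try lin; 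
  under_sw ltac:(rewrite -scalerAr)).
by rewrite (sw_antipoderK (f := fun p q => (h (antipode q) : k) *: p)); try lin.
Qed.
End Haar.

(** * Free Yetter-Drinfeld modules *)


Reserved Notation "\sw3_ ( x , y , z <- a ) E"
  (at level 41, x name, y name, z name, a at level 200, E at level 41,
   right associativity, format "\sw3_ ( x ,  y ,  z  <-  a )  E").
Notation "\sw3_ ( x , y , z <- a ) E" :=
  (sweedler (comul a) (fun x w => sweedler (comul w) (fun y z => E))) : ring_scope.

Section TensorLift.
Variables (k : fieldType) (V W U : lmodType k) (b : V -> W -> U).
Hypothesis b_bilinear : bilinear_map b.

Definition tlift : {linear tensor V W -> U} := linear_of (sweedler_linear b_bilinear).

Lemma tliftE v w : tlift (v ⊗ w) = b v w.
Proof. exact: sweedler_tens. Qed.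

End TensorLift.

Section Sw3.
Variables (k : fieldType) (A : hopfAlgType k).
Implicit Types (a b w : A) (U : lmodType k).

Lemma counitM a b : counit (a * b) = (counit a : k) * (counit b : k).
Proof. exact: rmorphM. Qed.

Lemma counit_antipode a : counit (antipode a) = counit a.
Proof.
have h : counit (\sw_(a1, a2 <- comul a) antipode a1 * a2) = counit a.
  by rewrite antipodel linearZ_LR rmorph1 -[LHS]/(_ * _) mulr1.
rewrite -h linear_sweedler.
rewrite -(sw_counitr (f := fun a1 => counit (antipode a1) : k^o)); try lin.
by apply: eq_sweedler => x y; rewrite rmorphM -[LHS]/(_ * _) mulrC.
Qed.

Lemma sw3M U (f : A -> A -> A -> U) a b :
  (forall y z, linear (fun x => f x y z)) ->
  (forall x z, linear (fun y => f x y z)) ->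
  (forall x y, linear (fun z => f x y z)) ->
  \sw3_(c1, c2, c3 <- a * b) f c1 c2 c3 =
  \sw3_(a1, a2, a3 <- a) \sw3_(b1, b2, b3 <- b) f (a1 * b1) (a2 * b2) (a3 * b3).
Proof.
move=> h1 h2 h3; rewrite sw_comulM; try lin.
apply: eq_sweedler => a1 x; rewrite [RHS]sw_exchange.
apply: eq_sweedler => b1 y.
by rewrite sw_comulM; try lin.
Qed.

(** Both sides are sums over the five-fold comultiplication of [a], the antipode reversing its two
    legs. Coassociativity of the free coaction and compatibility for cofree modules both reduce to
    this. *)
Lemma sw3_comulS U (f : A -> A -> A -> U) a w :
  (forall y z, linear (fun x => f x y z)) ->
  (forall x z, linear (fun y => f x y z)) ->
  (forall x y, linear (fun z => f x y z)) ->
  \sw3_(a1, a2, a3 <- a) \sw_(p, q <- comul (antipode a1 * w * a3)) f a2 p q =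
  \sw_(w1, w2 <- comul w) \sw3_(a1, a2, a3 <- a) \sw3_(b1, b2, b3 <- a2)
    f b2 (antipode b1 * w1 * b3) (antipode a1 * w2 * a3).
Proof.
move=> h1 h2 h3.
transitivity (\sw_(w1, w2 <- comul w) \sw_(a1, x <- comul a) \sw_(a2, y <- comul x)
   \sw_(a3, z <- comul y) \sw_(a4, a5 <- comul z)
   f a3 (antipode a2 * w1 * a4) (antipode a1 * w2 * a5)).
  transitivity (\sw_(a1, x <- comul a) \sw_(w1, w2 <- comul w) \sw_(c1, c2 <- comul a1)
    \sw_(a2, a3 <- comul x) \sw_(d1, d2 <- comul a3)
      f a2 (antipode c2 * w1 * d1) (antipode c1 * w2 * d2)).
    apply: eq_sweedler => a1 x.
    under [RHS]eq_sweedler do rewrite sw_exchange.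
    rewrite [RHS]sw_exchange; apply: eq_sweedler => a2 a3.
    rewrite sw_comulM; try lin.
    rewrite sw_comulM; try lin.
    rewrite sw_comul_antipode; try lin.
    rewrite sw_exchange; apply: eq_sweedler => w1 w2.
    by [].
  rewrite sw_exchange; apply: eq_sweedler => w1 w2.
  by rewrite coassoc; try lin.
apply: eq_sweedler => w1 w2; apply: eq_sweedler => a1 x.
rewrite coassoc; try lin.
apply: eq_sweedler => a2 y.
by rewrite coassoc; try lin.
Qed.

Lemma yd_coact_act (V : ydmodule A) (v : V) a :
  coact (yd_act v a) = \sw_(v0, v1 <- coact v)
    \sw3_(a1, a2, a3 <- a) (yd_act v0 a2) ⊗ (antipode a1 * v1 * a3).
Proof.
rewrite yd_compat coassoc; try lin.
under_sw ltac:(rewrite sw_exchange).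
by rewrite sw_exchange.
Qed.

Lemma sw_coact_act (V : ydmodule A) U (f : V -> A -> U) (v : V) a :
  bilinear_map f ->
  sweedler (coact (yd_act v a)) f = \sw_(v0, v1 <- coact v)
    \sw3_(a1, a2, a3 <- a) f (yd_act v0 a2) (antipode a1 * v1 * a3).
Proof.
move=> hf; rewrite yd_coact_act sw_sw //; apply: eq_sweedler => v0 v1.
rewrite sw_sw //; apply: eq_sweedler => a1 x.
rewrite sw_sw //; apply: eq_sweedler => a2 a3.
by rewrite sweedler_tens.
Qed.

End Sw3.

Section Free.
Variables (k : fieldType) (A : hopfAlgType k) (V : comodule A).

(** Forced by two demands: v ⊗ 1 coacts as v does, and right multiplication on the factor A
    satisfies the Yetter-Drinfeld condition. *)
Definition free_coact_pure (v : V) (a : A) : tensor (tensor V A) A :=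
  \sw_(v0, v1 <- coact v) \sw3_(a1, a2, a3 <- a) (v0 ⊗ a2) ⊗ (antipode a1 * v1 * a3).

Lemma free_coact_bilinear : bilinear_map free_coact_pure.
Proof. by rewrite /free_coact_pure; lin. Qed.

Definition free_coact : {linear tensor V A -> tensor (tensor V A) A} :=
  tlift free_coact_bilinear.

Lemma sw_free_coact (U : lmodType k) (f : tensor V A -> A -> U) v a :
  bilinear_map f ->
  sweedler (free_coact (v ⊗ a)) f = \sw_(v0, v1 <- coact v)
    \sw3_(a1, a2, a3 <- a) f (v0 ⊗ a2) (antipode a1 * v1 * a3).
Proof.
move=> hf; rewrite tliftE sw_sw //; apply: eq_sweedler => v0 v1.
rewrite sw_sw //; apply: eq_sweedler => a1 x.
rewrite sw_sw //; apply: eq_sweedler => a2 a3.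
by rewrite sweedler_tens.
Qed.

Lemma free_coactA (t : tensor V A) :
  \sw_(x, v2 <- free_coact t) \sw_(v0, v1 <- free_coact x) v0 ⊗ (v1 ⊗ v2) =
  \sw_(v0, x <- free_coact t) v0 ⊗ comul x.
Proof.
move: t; apply: tensor_ext => [||v a]; try lin.
rewrite !sw_free_coact; try lin.
transitivity (\sw_(v0, w <- coact v) \sw_(v1, v2 <- comul w)
  \sw3_(a1, a2, a3 <- a) \sw3_(b1, b2, b3 <- a2)
    (v0 ⊗ b2) ⊗ ((antipode b1 * v1 * b3) ⊗ (antipode a1 * v2 * a3))).
  rewrite -coact_coassoc; try lin.
  apply: eq_sweedler => v0 v2.
  rewrite sw_exchange; apply: eq_sweedler => a1 x.
  rewrite sw_exchange; apply: eq_sweedler => a2 a3.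
  by rewrite sw_free_coact; try lin.
apply: eq_sweedler => v0 w.
rewrite -(sw3_comulS (f := fun a2 p q => (v0 ⊗ a2) ⊗ (p ⊗ q))); try lin.
apply: eq_sweedler => a1 x; apply: eq_sweedler => a2 a3.
by rewrite {2}[comul _]tensorE (sw_push _ _ (f := fun u => _ ⊗ u)); try lin.
Qed.

Lemma free_coact_counit (t : tensor V A) :
  \sw_(v0, v1 <- free_coact t) counit v1 *: v0 = t.
Proof.
move: t; apply: tensor_ext => [||v a]; try lin.
rewrite sw_free_coact; try lin.
rewrite -[RHS](sw_coact_counit (f := fun v => v ⊗ a)); try lin.
apply: eq_sweedler => v0 v1.
rewrite -[X in _ = _ *: X](sw_counitl (f := fun a => v0 ⊗ a)); try lin.
rewrite sw_scale; apply: eq_sweedler => a1 x.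
rewrite -[X in _ = _ *: (_ *: X)](sw_counitr (f := fun a => v0 ⊗ a)); try lin.
rewrite !sw_scale; apply: eq_sweedler => a2 a3.
rewrite !counitM counit_antipode !scalerA.
by rewrite [X in X * _]mulrC.
Qed.

Definition free_comodule : comodule A :=
  @Comodule k A (tensor V A) free_coact free_coactA free_coact_counit.

Definition free_act (t : free_comodule) (b : A) : free_comodule :=
  \sw_(v, a <- t) (v ⊗ (a * b)).

Lemma free_act_bilinear : bilinear_map free_act.
Proof. rewrite /free_act; lin. Qed.

Lemma free_act_tens v a b : free_act (v ⊗ a) b = v ⊗ (a * b).
Proof. by rewrite /free_act sweedler_tens; try lin. Qed.

Lemma free_act1 t : free_act t 1 = t.
Proof.
move: t; apply: tensor_ext => [||v a]; [rewrite /free_act; lin|lin|].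
by rewrite free_act_tens mulr1.
Qed.

Lemma free_actM t a b : free_act t (a * b) = free_act (free_act t a) b.
Proof.
have [h _] := free_act_bilinear.
move: t; apply: tensor_ext => [||v c]; [exact: h| |].
  by apply: (linear_bill b free_act_bilinear).
by rewrite !free_act_tens mulrA.
Qed.

Lemma free_compat t b :
  free_coact (free_act t b) =
  \sw_(x, a3 <- comul b) \sw_(a1, a2 <- comul x) \sw_(v0, v1 <- free_coact t)
    (free_act v0 a2 : tensor V A) ⊗ (antipode a1 * v1 * a3).
Proof.
have hb := free_act_bilinear.
rewrite coassoc; try lin.
move: t; apply: tensor_ext => [||v a]; try lin.
rewrite free_act_tens tliftE /free_coact_pure.
transitivity (\sw_(v0, v1 <- coact v) \sw3_(a1, a2, a3 <- a) \sw3_(b1, b2, b3 <- b)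
   ((v0 ⊗ (a2 * b2)) ⊗ (antipode b1 * (antipode a1 * v1 * a3) * b3))).
  apply: eq_sweedler => v0 v1.
  rewrite sw3M; try lin.
  apply: eq_sweedler => a1 x; apply: eq_sweedler => a2 a3.
  apply: eq_sweedler => b1 y; apply: eq_sweedler => b2 b3.
  by rewrite antipodeM !mulrA.
under [RHS]eq_sweedler do under eq_sweedler do (rewrite sw_free_coact; try lin).
under [RHS]eq_sweedler do rewrite sw_exchange.
rewrite [RHS]sw_exchange; apply: eq_sweedler => v0 v1.
under [RHS]eq_sweedler do rewrite sw_exchange.
rewrite [RHS]sw_exchange; apply: eq_sweedler => a1 x.
under [RHS]eq_sweedler do rewrite sw_exchange.
rewrite [RHS]sw_exchange; apply: eq_sweedler => a2 a3.
apply: eq_sweedler => b1 y; apply: eq_sweedler => b2 b3.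
by rewrite free_act_tens.
Qed.

Definition free_yd : ydmodule A :=
  @YDModule k A free_comodule free_act free_act_bilinear free_act1 free_actM free_compat.

Lemma coact_free1 v :
  coact (v ⊗ 1 : free_comodule) = \sw_(v0, v1 <- coact v) (v0 ⊗ 1 : free_comodule) ⊗ v1.
Proof.
rewrite [LHS]tliftE; apply: eq_sweedler => v0 v1.
by rewrite sw_comul1 ?sw_comul1 ?antipode1 ?mul1r ?mulr1; try lin.
Qed.

End Free.

Section FreeUniversal.
Variables (k : fieldType) (A : hopfAlgType k) (V : comodule A) (X : ydmodule A).
Variable f : {linear V -> X}.
Hypothesis f_colinear :
  forall v, coact (f v) = \sw_(v0, v1 <- coact v) f v0 ⊗ v1.

Lemma free_lift_bilinear : bilinear_map (fun (v : V) (a : A) => yd_act (f v) a).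
Proof. lin. Qed.

Definition free_lift_lin : {linear free_yd V -> X} := tlift free_lift_bilinear.

Lemma free_liftE v a : free_lift_lin (v ⊗ a) = yd_act (f v) a.
Proof. exact: tliftE. Qed.

Lemma free_lift_act t a : free_lift_lin (yd_act t a) = yd_act (free_lift_lin t) a.
Proof.
have hb := free_act_bilinear V.
move: t; apply: tensor_ext => [||v b]; try by rewrite /= /free_act; lin.
by rewrite [yd_act _ a]free_act_tens !free_liftE yd_actM.
Qed.

Lemma free_lift_coact t :
  coact (free_lift_lin t) = \sw_(v0, v1 <- coact t) free_lift_lin v0 ⊗ v1.
Proof.
move: t; apply: tensor_ext => [||v b]; try by lin.
rewrite free_liftE yd_coact_act f_colinear sw_sw; try lin.
rewrite [RHS]sw_free_coact; try lin.
apply: eq_sweedler => v0 v1; rewrite sweedler_tens; try lin.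
by apply: eq_sweedler => a1 x; apply: eq_sweedler => a2 a3; rewrite free_liftE.
Qed.

(** The extension half of the adjunction between free Yetter-Drinfeld modules and the forgetful
    functor to comodules. *)
Definition free_lift : ydhom (free_yd V) X :=
  YDHom free_lift_act free_lift_coact.

End FreeUniversal.

(** * Syzygies *)


Section Kernel.
Variables (k : fieldType) (V W : lmodType k) (f : {linear V -> W}).

Definition ker_pred : {pred V} := fun v => f v == 0.

Lemma ker_pred_closed : submod_closed ker_pred.
Proof.
split=> [|c u v]; rewrite !unfold_in ?linear0 // => /eqP hu /eqP hv.
by rewrite linearP hu hv scaler0 addr0.
Qed.

HB.instance Definition _ := GRing.isSubmodClosed.Build k V ker_pred ker_pred_closed.

Definition ker := {v : V | ker_pred v}.
HB.instance Definition _ := SubType.on ker.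
HB.instance Definition _ := [Choice of ker by <:].
HB.instance Definition _ := [SubChoice_isSubLmodule of ker by <:].

Definition ker_val : {linear ker -> V} := \val.
Lemma ker_valP x : f (ker_val x) = 0.
Proof. by apply/eqP; exact: (valP x). Qed.
Lemma ker_val_inj : injective ker_val.
Proof. exact: val_inj. Qed.

Section Corestrict.
Variables (X : lmodType k) (e : {linear X -> V}).
Hypothesis fe : forall x, f (e x) = 0.
Definition corestrict_fun x : ker := exist _ (e x) (introT eqP (fe x)).
Lemma corestrict_linear : linear corestrict_fun.
Proof. by move=> c x y; apply: val_inj; rewrite /= linearP. Qed.
Definition corestrict : {linear X -> ker} := linear_of corestrict_linear.
End Corestrict.
End Kernel.

Section YDKernel.
Variables (k : fieldType) (A : hopfAlgType k) (P X : ydmodule A).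
Variables (p : ydhom P X) (s : {linear X -> P}).
Hypothesis s_colinear : forall x, coact (s x) = \sw_(x0, x1 <- coact x) s x0 ⊗ x1.
Hypothesis ps : forall x, p (s x) = x.

Let K := ker p.
Let i : {linear K -> P} := ker_val p.

Lemma ydker_proj_linear : linear (fun v => v - s (p v)).
Proof. lin. Qed.

Lemma ydker_projP v : p (linear_of ydker_proj_linear v) = 0.
Proof. by rewrite /= linearB ps subrr. Qed.

(** As [s] is colinear, so is this projection; it carries the coaction of [P] directly into K ⊗ A,
    with no need to recognize K ⊗ A inside P ⊗ A. It is not assumed A-linear: the action on [K] uses
    it only to land back in [K]. *)
Definition ydker_proj : {linear P -> K} := corestrict ydker_projP.
Let q := ydker_proj.

Lemma ydker_projE v : i (q v) = v - s (p v).
Proof. by []. Qed.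

Lemma ydker_val_proj v : p v = 0 -> i (q v) = v.
Proof. by move=> pv; rewrite ydker_projE pv linear0 subr0. Qed.

Lemma ydker_proj_val x : q (i x) = x.
Proof. by apply: (@ker_val_inj _ _ _ p); rewrite ydker_val_proj // ker_valP. Qed.

Lemma ydker_coact_linear : linear (fun x : K => \sw_(v0, v1 <- coact (i x)) q v0 ⊗ v1).
Proof. lin. Qed.

Definition ydker_coact : {linear K -> tensor K A} := linear_of ydker_coact_linear.

Lemma ydker_coactE x : ydker_coact x = \sw_(v0, v1 <- coact (i x)) q v0 ⊗ v1.
Proof. by []. Qed.

Lemma coact_ydker_proj v :
  coact (i (q v)) = \sw_(v0, v1 <- coact v) i (q v0) ⊗ v1.
Proof.
rewrite ydker_projE linearB s_colinear ydhom_coact sw_sw; try lin.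
under [in LHS]eq_sweedler do (rewrite sweedler_tens; try lin).
rewrite [X in X - _](tensorE (coact v)) -sumrB; apply: eq_bigr => r _.
by rewrite ydker_projE tensBl.
Qed.

Lemma sw_ydker_coact_proj (U : lmodType k) (f : K -> A -> U) v : bilinear_map f ->
  sweedler (ydker_coact (q v)) f = \sw_(v0, v1 <- coact v) f (q v0) v1.
Proof.
move=> hf; rewrite ydker_coactE sw_sw //.
under [in LHS]eq_sweedler do (rewrite sweedler_tens; try lin).
rewrite coact_ydker_proj sw_sw; try lin.
by apply: eq_sweedler => v0 v1; rewrite sweedler_tens ?ydker_proj_val; try lin.
Qed.

Lemma coact_ydker_val x : coact (i x) = \sw_(x0, x1 <- ydker_coact x) i x0 ⊗ x1.
Proof.
rewrite -[x in RHS]ydker_proj_val sw_ydker_coact_proj; try lin.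
by rewrite -coact_ydker_proj ydker_proj_val.
Qed.

Lemma ydker_coactA x :
  \sw_(y, v2 <- ydker_coact x) \sw_(v0, v1 <- ydker_coact y) v0 ⊗ (v1 ⊗ v2) =
  \sw_(v0, y <- ydker_coact x) v0 ⊗ comul y.
Proof.
rewrite -[x]ydker_proj_val !sw_ydker_coact_proj; try lin.
under [in LHS]eq_sweedler do (rewrite sw_ydker_coact_proj; try lin).
rewrite coact_coassoc; try lin.
apply: eq_sweedler => v0 y.
by rewrite [in RHS](tensorE (comul y)) (sw_push _ _ (f := fun u => _ ⊗ u)); try lin.
Qed.

Lemma ydker_coact_counit x : \sw_(v0, v1 <- ydker_coact x) counit v1 *: v0 = x.
Proof.
rewrite -[x]ydker_proj_val !sw_ydker_coact_proj; try lin.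
by rewrite (sw_coact_counit (f := q)); try lin.
Qed.

Definition ydker_comodule : comodule A :=
  @Comodule k A K ydker_coact ydker_coactA ydker_coact_counit.

Definition ydker_act (x : ydker_comodule) (a : A) : ydker_comodule :=
  q (yd_act (i x) a).

Lemma ydker_act_bilinear : bilinear_map ydker_act.
Proof. rewrite /ydker_act; lin. Qed.

Lemma ydker_val_act (x : ydker_comodule) a : i (ydker_act x a) = yd_act (i x) a.
Proof.
apply: ydker_val_proj; rewrite ydhom_act ker_valP.
exact: (linear0 (linear_of ((yd_act_bilinear X).1 a))).
Qed.

Lemma ydker_act1 x : ydker_act x 1 = x.
Proof. by rewrite /ydker_act yd_act1 ydker_proj_val. Qed.

Lemma ydker_actM x a b : ydker_act x (a * b) = ydker_act (ydker_act x a) b.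
Proof. by rewrite {1}/ydker_act yd_actM -ydker_val_act. Qed.

Lemma ydker_compat (x : ydker_comodule) a :
  ydker_coact (ydker_act x a) =
  \sw_(y, a3 <- comul a) \sw_(a1, a2 <- comul y) \sw_(v0, v1 <- ydker_coact x)
    (ydker_act v0 a2 : K) ⊗ (antipode a1 * v1 * a3).
Proof.
have hb := ydker_act_bilinear.
rewrite coassoc; try lin.
rewrite ydker_coactE ydker_val_act sw_coact_act; try lin.
rewrite coact_ydker_val sw_sw; try lin.
under [RHS]eq_sweedler do rewrite sw_exchange.
rewrite [RHS]sw_exchange; apply: eq_sweedler => v0 v1.
by rewrite sweedler_tens; try lin.
Qed.

Definition ydker : ydmodule A :=
  @YDModule k A ydker_comodule ydker_act ydker_act_bilinear ydker_act1 ydker_actM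
    ydker_compat.

Definition ydker_in : ydhom ydker P :=
  @YDHom k A ydker P i ydker_val_act coact_ydker_val.

End YDKernel.

Section Syzygy.
Variables (k : fieldType) (A : hopfAlgType k).
Implicit Type X : ydmodule A.

Lemma id_colinear X (v : X) : coact (idfun v) = \sw_(v0, v1 <- coact v) idfun v0 ⊗ v1.
Proof. exact: tensorE. Qed.

Definition free_counit X : ydhom (free_yd X) X := free_lift (@id_colinear X).

Lemma free_counitE X (x : X) a : free_counit X (x ⊗ a) = yd_act x a.
Proof. exact: free_liftE. Qed.

Definition free_unit X : {linear X -> free_yd X} :=
  linear_of ((tens_bilinear X A).1 1).

Lemma free_unitK X (x : X) : free_counit X (free_unit X x) = x.
Proof. by rewrite free_counitE yd_act1. Qed.

Lemma free_unit_colinear X (x : X) :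
  coact (free_unit X x) = \sw_(x0, x1 <- coact x) free_unit X x0 ⊗ x1.
Proof. exact: coact_free1. Qed.

Definition syz X : ydmodule A := ydker (@free_unit_colinear X) (@free_unitK X).

Definition syz_in X : ydhom (syz X) (free_yd X) :=
  ydker_in (@free_unit_colinear X) (@free_unitK X).

Definition syz_proj X : {linear free_yd X -> syz X} := ydker_proj (@free_unitK X).

Lemma syz_in_inj X : injective (syz_in X).
Proof. exact: ker_val_inj. Qed.

Lemma free_counit_syz X x : free_counit X (syz_in X x) = 0.
Proof. exact: ker_valP. Qed.

Lemma syz_in_proj X v : syz_in X (syz_proj X v) = v - free_unit X (free_counit X v).
Proof. by []. Qed.

Lemma syz_proj_in X x : syz_proj X (syz_in X x) = x.
Proof. exact: ydker_proj_val. Qed.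

End Syzygy.

(** * Averaging *)


Ltac sw_swap := under [LHS]eq_sweedler do rewrite sw_exchange.

Section Averaging.
Variables (k : fieldType) (A : hopfAlgType k).
Variable h : {linear A -> k^o}.
Hypothesis h1 : h 1 = 1.
Hypothesis h_invariant : forall a : A,
  \sw_(a1, a2 <- comul a) (h a2 : k) *: a1 = (h a : k) *: (1 : A).

(** Both sides equal the sum of h(y_2 S(x_1)) y_1 S(x_2) x_3: one by S(x_2) x_3, the other by
    invariance of [h] at y S(x_1). It exchanges a leg of y for a leg of x and is the source of all
    colinearity below. *)
Lemma haar_shift (U : lmodType k) (f : A -> U) x y : linear f ->
  \sw_(y1, y2 <- comul y) (h (y2 * antipode x) : k) *: f y1 =
  \sw_(x1, x2 <- comul x) (h (y * antipode x1) : k) *: f x2.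
Proof.
move=> hf.
transitivity (f (\sw_(y1, y2 <- comul y) (h (y2 * antipode x) : k) *: y1)).
  by rewrite (sw_push _ _ hf); apply: eq_sweedler => y1 y2; rewrite (linearZ_of _ _ hf).
transitivity (f (\sw_(x1, x2 <- comul x) (h (y * antipode x1) : k) *: x2)); last first.
  by rewrite (sw_push _ _ hf); apply: eq_sweedler => y1 y2; rewrite (linearZ_of _ _ hf).
congr f; symmetry.
transitivity (\sw_(y1, y2 <- comul y) \sw_(c1, z <- comul x) \sw_(c2, x2 <- comul z)
    (h (y2 * antipode c1) : k) *: (y1 * (antipode c2 * x2))).
  under_sw ltac:(rewrite -[X in _ *: X]mul1r scalerAl -h_invariant
    (sw_push _ _ (f := fun u => u * _)); try lin).
  under_sw ltac:(rewrite sw_comulM; try lin).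
  rewrite [LHS]sw_exchange; apply: eq_sweedler => y1 y2.
  under_sw ltac:(rewrite sw_comul_antipode; try lin).
  rewrite coassoc; try lin.
  apply: eq_sweedler => c1 z; apply: eq_sweedler => c2 x2.
  by rewrite -scalerAl mulrA.
apply: eq_sweedler => y1 y2.
under_sw ltac:(rewrite (sw_antipodel (f := fun u => (h _ : k) *: (y1 * u))); try lin).
by rewrite mulr1 (sw_counitr (f := fun u => (h (y2 * antipode u) : k) *: y1)); try lin.
Qed.

Section Average.
Variables (V X : comodule A) (g : {linear V -> X}).

(** The analogue of averaging the conjugates of a linear map over a finite group, with [h] in the
    role of the mean. *)
Definition average_fun (v : V) : X :=
  \sw_(v0, v1 <- coact v) \sw_(y0, y1 <- coact (g v0))
    (h (y1 * antipode v1) : k) *: y0.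

Lemma average_linear : linear average_fun.
Proof. rewrite /average_fun; lin. Qed.

Definition average : {linear V -> X} := linear_of average_linear.

Lemma averageE v : average v = \sw_(v0, v1 <- coact v)
  \sw_(y0, y1 <- coact (g v0)) (h (y1 * antipode v1) : k) *: y0.
Proof. by []. Qed.

Lemma average_colinear v :
  coact (average v) = \sw_(v0, v1 <- coact v) average v0 ⊗ v1.
Proof.
transitivity (\sw_(v0, w <- coact v) \sw_(v1, v2 <- comul w)
   \sw_(y0, y1 <- coact (g v0)) (h (y1 * antipode v1) : k) *: (y0 ⊗ v2)).
  rewrite averageE linear_sweedler; apply: eq_sweedler => v0 w.
  rewrite linear_sweedler.
  under_sw ltac:(rewrite linearZ_LR [coact _]tensorE [LHS]sw_scale).
  rewrite coact_coassoc; try lin.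
  rewrite [RHS]sw_exchange; apply: eq_sweedler => y0 y.
  by rewrite (haar_shift (f := fun u => y0 ⊗ u)); try lin.
rewrite -coact_coassoc; try lin.
apply: eq_sweedler => v0 v2; rewrite averageE.
rewrite (sw_push _ _ (f := fun u => u ⊗ _)); try lin.
apply: eq_sweedler => u0 u1; rewrite (sw_push _ _ (f := fun u => u ⊗ _)); try lin.
by apply: eq_sweedler => y0 y1; rewrite tensZl.
Qed.

(** Where p g is already colinear, the weight becomes h(v_1 S(v_2)), and averaging changes nothing
    because h(1) = 1. *)
Lemma average_lift (Y : comodule A) (p : {linear X -> Y}) :
  (forall x, coact (p x) = \sw_(x0, x1 <- coact x) p x0 ⊗ x1) ->
  (forall v, coact (p (g v)) = \sw_(v0, v1 <- coact v) p (g v0) ⊗ v1) ->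
  forall v, p (average v) = p (g v).
Proof.
move=> p_col pg_col v.
transitivity (\sw_(v0, v1 <- coact v) \sw_(y0, y1 <- coact (p (g v0)))
    (h (y1 * antipode v1) : k) *: y0).
  rewrite averageE linear_sweedler; apply: eq_sweedler => v0 v1.
  rewrite linear_sweedler p_col sw_sw; try lin.
  by apply: eq_sweedler => y0 y1; rewrite sweedler_tens ?linearZ_LR; try lin.
transitivity (\sw_(v0, w <- coact v) \sw_(v1, v2 <- comul w)
   (h (v1 * antipode v2) : k) *: p (g v0)).
  rewrite -coact_coassoc; try lin.
  apply: eq_sweedler => v0 v1; rewrite pg_col sw_sw; try lin.
  by apply: eq_sweedler => y0 y1; rewrite sweedler_tens; try lin.
under_sw ltac:(rewrite (sw_antipoder (f := fun u => (h u : k) *: _)); try lin;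
  rewrite h1 scale1r).
by rewrite (sw_coact_counit (f := fun u => p (g u))); try lin.
Qed.

End Average.

(** By freeness only the generators v ⊗ 1 have to be lifted, colinearly: lift linearly, average,
    then extend. No A-linear map is averaged here. *)
Lemma free_projective (V : comodule A) (X Y : ydmodule A)
    (f : ydhom (free_yd V) Y) (g : ydhom X Y) :
  (forall t, exists x, f t = g x) ->
  exists l : ydhom (free_yd V) X, forall t, g (l t) = f t.
Proof.
move=> fg.
have lf0 : linear (fun v : V => f (v ⊗ 1)) by lin.
pose f0 := linear_of lf0.
have [g0 gg0] : exists g0 : {linear V -> X}, forall v, g (g0 v) = f0 v.
  by apply: linear_lift => v; apply: fg.
have f0_col v : coact (g (g0 v)) = \sw_(v0, v1 <- coact v) g (g0 v0) ⊗ v1.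
  rewrite gg0 -[f0 v]/(f (v ⊗ 1)) (ydhom_coact f) coact_free1 sw_sw; try lin.
  by apply: eq_sweedler => v0 v1; rewrite sweedler_tens ?gg0; try lin.
exists (free_lift (average_colinear g0)) => t.
move: t; apply: tensor_ext => [||v a]; try lin.
rewrite free_liftE ydhom_act average_lift //; last exact: ydhom_coact.
by rewrite gg0 -[f0 v]/(f (v ⊗ 1)) -(ydhom_act f) [yd_act _ a]free_act_tens mul1r.
Qed.

End Averaging.

Section Cancel.
Variables (k : fieldType) (A : hopfAlgType k) (U : lmodType k).

(** In five legs the left side is f(a_1 S(a_2), a_3, a_4 S(a_5)), which collapses at both ends. *)
Lemma sw3_cancel (f : A -> A -> A -> U) a :
  (forall y z, linear (fun x => f x y z)) ->
  (forall x z, linear (fun y => f x y z)) ->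
  (forall x y, linear (fun z => f x y z)) ->
  \sw3_(a1, a2, a3 <- a) \sw3_(b1, b2, b3 <- a2)
    f (a1 * antipode b1) b2 (b3 * antipode a3) = f 1 a 1.
Proof.
move=> f1 f2 f3.
rewrite -[RHS](sw_antipoderK (f := fun p q => f p q 1)); try lin.
apply: eq_sweedler => a1 x.
rewrite coassoc; try lin.
apply: eq_sweedler => b1 z.
rewrite coassoc; try lin.
under_sw ltac:(rewrite (sw_antipoder (f := fun u => f (a1 * antipode b1) _ u)); try lin).
by rewrite sw_counitr; try lin.
Qed.

End Cancel.

(** * Averaging A-linear maps into free Yetter-Drinfeld modules *)

Section Retraction.
Variables (k : fieldType) (A : hopfAlgType k).
Variable h : {linear A -> k^o}.
Hypothesis h1 : h 1 = 1.
Hypothesis h_invariant : forall a : A,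
  \sw_(a1, a2 <- comul a) (h a2 : k) *: a1 = (h a : k) *: (1 : A).
Variable V : comodule A.

(** A retraction, in Yetter-Drinfeld modules, of the coaction t |-> t_0 ⊗ t_1 of F = V ⊠ A. Here F ⊗
    A carries the coaction of its second factor and the action (t ⊗ b) a = t a_2 ⊗ S(a_1) b a_3, as
    in cofree modules. [retract_act], [retract_coact] and [retract_unit] are its three
    properties. *)
Definition retract_fun (t : free_yd V) (b : A) : free_yd V :=
  \sw_(v, c <- t) \sw_(v0, v1 <- coact v) \sw3_(c1, c2, c3 <- c)
    (h (v1 * c3 * antipode b * antipode (antipode (antipode c1))) : k) *: (v0 ⊗ c2).

Lemma retract_bilinear : bilinear_map retract_fun.
Proof. rewrite /retract_fun; lin. Qed.

Lemma retract_tens v c b : retract_fun (v ⊗ c) b =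
  \sw_(v0, v1 <- coact v) \sw3_(c1, c2, c3 <- c)
    (h (v1 * c3 * antipode b * antipode (antipode (antipode c1))) : k) *: (v0 ⊗ c2).
Proof. by rewrite /retract_fun sweedler_tens; try lin. Qed.

(** Acting by a turns S(b) into S(a_3) S(b) S^2(a_1) and c into c a_2. With b_1, b_2, b_3 now the
    legs of a_2, the products b_3 S(a_3) and S^2(a_1) S^3(b_1) = S^2(a_1 S(b_1)) both collapse; the
    second one fixes the exponent 3. *)
Lemma retract_act t b a :
  \sw3_(a1, a2, a3 <- a) retract_fun (yd_act t a2) (antipode a1 * b * a3) =
  yd_act (retract_fun t b) a.
Proof.
have hr := retract_bilinear; have hb := free_act_bilinear V.
move: t; apply: tensor_ext => [||v c]; try lin.
rewrite retract_tens.
transitivity (\sw_(v0, v1 <- coact v) \sw3_(c1, c2, c3 <- c)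
   \sw3_(a1, a2, a3 <- a) \sw3_(b1, b2, b3 <- a2)
   (h (v1 * c3 * (b3 * antipode a3) * antipode b *
       antipode (antipode (a1 * antipode b1)) *
       antipode (antipode (antipode c1))) : k) *: (v0 ⊗ (c2 * b2))).
  under [LHS]eq_sweedler do under eq_sweedler do rewrite [yd_act _ _]free_act_tens retract_tens.
  sw_swap; rewrite [LHS]sw_exchange; apply: eq_sweedler => v0 v1.
  under [LHS]eq_sweedler do under eq_sweedler do (rewrite sw3M; try lin).
  sw_swap; rewrite [LHS]sw_exchange; apply: eq_sweedler => c1 x.
  sw_swap; rewrite [LHS]sw_exchange; apply: eq_sweedler => c2 c3.
  apply: eq_sweedler => a1 y; apply: eq_sweedler => a2 a3.
  apply: eq_sweedler => b1 z; apply: eq_sweedler => b2 b3.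
  by rewrite !antipodeM !mulrA.
rewrite (sw_push _ _ (f := fun u => yd_act u a)); try lin.
apply: eq_sweedler => v0 v1.
rewrite (sw_push _ _ (f := fun u => yd_act u a)); try lin.
apply: eq_sweedler => c1 x.
rewrite (sw_push _ _ (f := fun u => yd_act u a)); try lin.
apply: eq_sweedler => c2 c3.
rewrite (sw3_cancel (f := fun p q r =>  (h (v1 * c3 * r * antipode b *
       antipode (antipode p) *
       antipode (antipode (antipode c1))) : k) *: (v0 ⊗ (c2 * q)))); try lin.
by rewrite -[yd_act _ a]/(free_act _ a) (linearZ_of _ _ (hb.1 a)) free_act_tens
  !antipode1 !mulr1.
Qed.

Lemma sw_comul_antipode2 (U : lmodType k) (f : A -> A -> U) a : bilinear_map f ->
  sweedler (comul (antipode (antipode a))) f =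
  \sw_(a1, a2 <- comul a) f (antipode (antipode a1)) (antipode (antipode a2)).
Proof. by move=> hf; rewrite !sw_comul_antipode; try lin. Qed.

(** Since S(b) S^3(c_1) = S(S^2(c_1) b), the weight has the form h(y S(x)) and [haar_shift] applies.
    It brings out a leg S^2(f_2) b_2, and S(d_1) S^2(f_2) = S(S(f_2) d_1) then collapses, leaving
    b_2. *)
Lemma retract_coact_pure u0 w c b :
  \sw_(w1, w2 <- comul w) \sw3_(c1, c2, c3 <- c) \sw3_(d1, d2, d3 <- c2)
    (h (w2 * c3 * antipode b * antipode (antipode (antipode c1))) : k) *:
      ((u0 ⊗ d2 : tensor V A) ⊗ (antipode d1 * w1 * d3)) =
  \sw_(b1, b2 <- comul b) \sw3_(c1, c2, c3 <- c)
    (h (w * c3 * antipode b1 * antipode (antipode (antipode c1))) : k) *: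
      ((u0 ⊗ c2 : tensor V A) ⊗ b2).
Proof.
rewrite [LHS]sw_exchange.
transitivity (\sw_(c1, z <- comul c) \sw_(f1, f2 <- comul c1) \sw_(d1, z2 <- comul z)
  \sw_(d2, e <- comul z2) \sw_(b1, b2 <- comul b)
    (h (w * e * antipode (antipode (antipode f1) * b1)) : k) *:
      ((u0 ⊗ d2 : tensor V A) ⊗ (antipode (antipode f2 * d1) * b2))).
  apply: eq_sweedler => c1 z.
  under [LHS]eq_sweedler do (rewrite coassoc; try lin).
  rewrite [LHS]sw_exchange [RHS]sw_exchange; apply: eq_sweedler => d1 z2.
  under [LHS]eq_sweedler do (rewrite coassoc; try lin).
  rewrite [LHS]sw_exchange [RHS]sw_exchange; apply: eq_sweedler => d2 e.
  transitivity (\sw_(y1, y2 <- comul (w * e))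
    (h (y2 * antipode (antipode (antipode c1) * b)) : k) *:
      ((u0 ⊗ d2 : tensor V A) ⊗ (antipode d1 * y1))).
    rewrite sw_comulM; try lin.
    apply: eq_sweedler => w1 w2; apply: eq_sweedler => d3 c3.
    by rewrite !antipodeM !mulrA.
  rewrite (haar_shift h_invariant (f := fun u => (u0 ⊗ d2) ⊗ (antipode d1 * u))); try lin.
  rewrite sw_comulM; try lin.
  rewrite sw_comul_antipode2; try lin.
  apply: eq_sweedler => f1 f2; apply: eq_sweedler => b1 b2.
  by rewrite [antipode (antipode f2 * d1)]antipodeM !mulrA.
rewrite coassoc; try lin.
rewrite [RHS]sw_exchange; apply: eq_sweedler => f1 z0.
rewrite (sw_antipodelK (f := fun p q => \sw_(d2, e <- comul q) \sw_(b1, b2 <- comul b)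
    (h (w * e * antipode (antipode (antipode f1) * b1)) : k) *:
      ((u0 ⊗ d2 : tensor V A) ⊗ (antipode p * b2)))); try lin.
rewrite [RHS]sw_exchange; apply: eq_sweedler => d2 e.
apply: eq_sweedler => b1 b2.
by rewrite antipode1 mul1r antipodeM !mulrA.
Qed.

Lemma retract_coact t b :
  coact (retract_fun t b) = \sw_(b1, b2 <- comul b) retract_fun t b1 ⊗ b2.
Proof.
have hr := retract_bilinear; have hb := free_act_bilinear V.
move: t; apply: tensor_ext => [||v c]; try lin.
rewrite retract_tens.
transitivity (\sw_(v0, v1 <- coact v) \sw_(u0, u1 <- coact v0)
   \sw3_(c1, c2, c3 <- c) \sw3_(d1, d2, d3 <- c2)
   (h (v1 * c3 * antipode b * antipode (antipode (antipode c1))) : k) *: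
     ((u0 ⊗ d2 : free_yd V) ⊗ (antipode d1 * u1 * d3))).
  rewrite linear_sweedler; apply: eq_sweedler => v0 v1.
  rewrite linear_sweedler [RHS]sw_exchange; apply: eq_sweedler => c1 x.
  rewrite linear_sweedler [RHS]sw_exchange; apply: eq_sweedler => c2 c3.
  rewrite linearZ_LR [X in _ *: X = _]tliftE [LHS]sw_scale; apply: eq_sweedler => u0 u1.
  rewrite sw_scale; apply: eq_sweedler => d1 y.
  by rewrite sw_scale.
rewrite coact_coassoc; try lin.
under [RHS]eq_sweedler do (rewrite retract_tens (sw_push _ _ (f := fun u => u ⊗ _)); try lin).
rewrite [RHS]sw_exchange; apply: eq_sweedler => u0 w.
rewrite [LHS]retract_coact_pure.
apply: eq_sweedler => b1 b2.
rewrite (sw_push _ _ (f := fun u => u ⊗ _)); try lin.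
apply: eq_sweedler => c1 x.
rewrite (sw_push _ _ (f := fun u => u ⊗ _)); try lin.
by apply: eq_sweedler => c2 c3; rewrite tensZl.
Qed.

Lemma retract_unit t : \sw_(t0, b <- coact t) retract_fun t0 b = t.
Proof.
have hr := retract_bilinear.
move: t; apply: tensor_ext => [||v a]; try lin.
rewrite [LHS]sw_free_coact; try lin.
transitivity (\sw_(v0, v1 <- coact v) \sw_(u0, u1 <- coact v0)
   (h (u1 * antipode v1) : k) *: (u0 ⊗ a)).
  apply: eq_sweedler => v0 v1.
  under [LHS]eq_sweedler do under eq_sweedler do rewrite retract_tens.
  sw_swap; rewrite [LHS]sw_exchange; apply: eq_sweedler => u0 u1.
  transitivity (\sw3_(a1, a2, a3 <- a) \sw3_(b1, b2, b3 <- a2)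
     (h (u1 * (b3 * antipode a3) * antipode v1 *
       antipode (antipode (a1 * antipode b1))) : k) *: (u0 ⊗ b2)).
    apply: eq_sweedler => a1 y; apply: eq_sweedler => a2 a3.
    apply: eq_sweedler => b1 z; apply: eq_sweedler => b2 b3.
    by rewrite !antipodeM !mulrA.
  rewrite (sw3_cancel (f := fun p q r => (h (u1 * r * antipode v1 *
     antipode (antipode p)) : k) *: (u0 ⊗ q))); try lin.
  by rewrite !antipode1 !mulr1.
rewrite coact_coassoc; try lin.
under_sw ltac:(rewrite (sw_antipoder (f := fun u => (h u : k) *: _)); try lin;
  rewrite h1 scale1r).
by rewrite (sw_coact_counit (f := fun u => u ⊗ a)); try lin.
Qed.

Section RetractHom.
Variables (X : ydmodule A) (g : {linear X -> free_yd V}).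
Hypothesis g_act : forall x a, g (yd_act x a) = yd_act (g x) a.

Lemma retract_hom_linear : linear (fun x => \sw_(x0, b <- coact x) retract_fun (g x0) b).
Proof. have hr := retract_bilinear; lin. Qed.

Let l : {linear X -> free_yd V} := linear_of retract_hom_linear.
Let lE x : l x = \sw_(x0, b <- coact x) retract_fun (g x0) b.
Proof. by []. Qed.

Lemma retract_hom_act x a : l (yd_act x a) = yd_act (l x) a.
Proof.
have hr := retract_bilinear.
rewrite !lE sw_coact_act; try lin.
rewrite (sw_push _ _ (f := fun u => yd_act u a)); try lin.
apply: eq_sweedler => x0 b; rewrite -retract_act.
by apply: eq_sweedler => a1 y; apply: eq_sweedler => a2 a3; rewrite g_act.
Qed.

Lemma retract_hom_coact x : coact (l x) = \sw_(x0, x1 <- coact x) l x0 ⊗ x1.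
Proof.
have hr := retract_bilinear.
rewrite lE linear_sweedler.
under [LHS]eq_sweedler do rewrite retract_coact.
rewrite -coact_coassoc; try lin.
apply: eq_sweedler => x0 x1; rewrite lE.
by rewrite (sw_push _ _ (f := fun u => u ⊗ _)); try lin.
Qed.

Definition retract_hom : ydhom X (free_yd V) := @YDHom k A X (free_yd V) l retract_hom_act retract_hom_coact.

(** Along [i] the map [g] is already a Yetter-Drinfeld morphism, so there the average is undone by
    [retract_unit]. *)
Lemma retract_homE (Y : ydmodule A) (i : ydhom Y X) (f : ydhom Y (free_yd V)) :
  (forall y, g (i y) = f y) -> forall y, retract_hom (i y) = f y.
Proof.
have hr := retract_bilinear.
move=> gi y; rewrite [LHS]lE ydhom_coact sw_sw; try lin.
under [LHS]eq_sweedler do (rewrite sweedler_tens; try lin).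
under [LHS]eq_sweedler do rewrite gi.
rewrite -[RHS]retract_unit (ydhom_coact f) sw_sw; try lin.
by apply: eq_sweedler => y0 y1; rewrite sweedler_tens; try lin.
Qed.

End RetractHom.
End Retraction.

(** * Cofree modules and injective resolutions *)


Section LinearHom.
Variables (k : fieldType) (V W : lmodType k).

Definition lhom_pred : {pred V -> W} := fun f => `[< linear f >].

Lemma lhom_pred_closed : submod_closed lhom_pred.
Proof.
split=> [|c f g]; rewrite !unfold_in.
  by apply/asboolP => c u v; rewrite /= scaler0 addr0.
move=> /asboolP hf /asboolP hg; apply/asboolP => a u v.
by rewrite !fctE hf hg !scalerDr !scalerA [c * a]mulrC addrACA.
Qed.

HB.instance Definition _ := GRing.isSubmodClosed.Build k (V -> W) lhom_pred lhom_pred_closed.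

Definition lhom := {f : V -> W | lhom_pred f}.
HB.instance Definition _ := SubType.on lhom.
HB.instance Definition _ := [Choice of lhom by <:].
HB.instance Definition _ := [SubChoice_isSubLmodule of lhom by <:].

Definition lhom_app (f : lhom) (v : V) : W := val f v.

Lemma lhom_app_bilinear : bilinear_map lhom_app.
Proof.
split=> [v c f g|f]; first by rewrite /lhom_app linearP.
by apply/asboolP; exact: (valP f).
Qed.

Lemma lhom_ext (f g : lhom) : (forall v, lhom_app f v = lhom_app g v) -> f = g.
Proof. by move=> fg; apply/val_inj/funext. Qed.

Definition lhom_mk (f : V -> W) (hf : linear f) : lhom := exist _ f (introT (asboolP _) hf).

Lemma lhom_mkE f (hf : linear f) v : lhom_app (lhom_mk hf) v = f v.
Proof. by []. Qed.

End LinearHom.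

Section Cofree.
Variables (k : fieldType) (A : hopfAlgType k) (W : lmodType k).
Let M := lhom A W.

Lemma hom_act_linear (m : M) a : linear (fun b => lhom_app m (a * b)).
Proof. have hb := lhom_app_bilinear A W; lin. Qed.

Definition hom_act (m : M) (a : A) : M := lhom_mk (hom_act_linear m a).

Lemma hom_act_bilinear : bilinear_map hom_act.
Proof.
have [h h'] := lhom_app_bilinear A W.
split=> [a c m n|m c a b]; apply: lhom_ext => x; rewrite h !lhom_mkE ?h //.
by rewrite mulrDl -scalerAl h'.
Qed.

Lemma hom_act1 m : hom_act m 1 = m.
Proof. by apply: lhom_ext => x; rewrite lhom_mkE mul1r. Qed.

Lemma hom_actM m a b : hom_act m (a * b) = hom_act (hom_act m a) b.
Proof. by apply: lhom_ext => x; rewrite !lhom_mkE mulrA. Qed.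

Lemma cofree_coact_bilinear : bilinear_map (fun (m : M) (b : A) =>
  \sw_(b1, b2 <- comul b) (m ⊗ b1) ⊗ b2).
Proof. lin. Qed.

Definition cofree_coact : {linear tensor M A -> tensor (tensor M A) A} :=
  tlift cofree_coact_bilinear.

Lemma sw_cofree_coact (U : lmodType k) (f : tensor M A -> A -> U) m b :
  bilinear_map f ->
  sweedler (cofree_coact (m ⊗ b)) f = \sw_(b1, b2 <- comul b) f (m ⊗ b1) b2.
Proof.
move=> hf; rewrite tliftE sw_sw //; apply: eq_sweedler => b1 b2.
by rewrite sweedler_tens.
Qed.

Lemma cofree_coactA t :
  \sw_(x, v2 <- cofree_coact t) \sw_(v0, v1 <- cofree_coact x) v0 ⊗ (v1 ⊗ v2) =
  \sw_(v0, x <- cofree_coact t) v0 ⊗ comul x.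
Proof.
move: t; apply: tensor_ext => [||m b]; try lin.
rewrite !sw_cofree_coact; try lin.
under [LHS]eq_sweedler do (rewrite sw_cofree_coact; try lin).
rewrite coassoc; try lin.
apply: eq_sweedler => b1 y.
by rewrite [in RHS](tensorE (comul y)) (sw_push _ _ (f := fun u => _ ⊗ u)); try lin.
Qed.

Lemma cofree_coact_counit t : \sw_(v0, v1 <- cofree_coact t) counit v1 *: v0 = t.
Proof.
move: t; apply: tensor_ext => [||m b]; try lin.
rewrite sw_cofree_coact; try lin.
by rewrite (sw_counitr (f := fun u => m ⊗ u)); try lin.
Qed.

Definition cofree_comodule : comodule A :=
  @Comodule k A (tensor M A) cofree_coact cofree_coactA cofree_coact_counit.

Definition cofree_act (t : cofree_comodule) (a : A) : cofree_comodule :=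
  \sw_(m, b <- t) \sw3_(a1, a2, a3 <- a) (hom_act m a2 ⊗ (antipode a1 * b * a3)).

Lemma cofree_act_bilinear : bilinear_map cofree_act.
Proof. have hb := hom_act_bilinear; rewrite /cofree_act; lin. Qed.

Lemma cofree_act_tens m b a : cofree_act (m ⊗ b) a =
  \sw3_(a1, a2, a3 <- a) (hom_act m a2 ⊗ (antipode a1 * b * a3)).
Proof. by have hb := hom_act_bilinear; rewrite /cofree_act sweedler_tens; try lin. Qed.

Lemma cofree_act1 t : cofree_act t 1 = t.
Proof.
have hb := hom_act_bilinear; have hc := cofree_act_bilinear.
move: t; apply: tensor_ext => [||m b]; try lin.
rewrite cofree_act_tens sw_comul1; try lin.
by rewrite sw_comul1 ?antipode1 ?mul1r ?mulr1 ?hom_act1; try lin.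
Qed.

Lemma cofree_actM t a b : cofree_act t (a * b) = cofree_act (cofree_act t a) b.
Proof.
have hb := hom_act_bilinear; have hc := cofree_act_bilinear.
move: t; apply: tensor_ext => [||m c]; try lin.
rewrite !cofree_act_tens sw3M; try lin.
rewrite (sw_push _ _ (f := fun u => cofree_act u b)); try lin.
apply: eq_sweedler => a1 x.
rewrite (sw_push _ _ (f := fun u => cofree_act u b)); try lin.
apply: eq_sweedler => a2 a3; rewrite cofree_act_tens.
apply: eq_sweedler => b1 y; apply: eq_sweedler => b2 b3.
by rewrite hom_actM antipodeM !mulrA.
Qed.

Lemma cofree_compat t a :
  cofree_coact (cofree_act t a) =
  \sw_(x, a3 <- comul a) \sw_(a1, a2 <- comul x) \sw_(v0, v1 <- cofree_coact t)
    (cofree_act v0 a2 : tensor M A) ⊗ (antipode a1 * v1 * a3).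
Proof.
have hb := hom_act_bilinear; have hc := cofree_act_bilinear.
rewrite coassoc; try lin.
move: t; apply: tensor_ext => [||m b]; try lin.
transitivity (\sw3_(a1, a2, a3 <- a) \sw_(p, q <- comul (antipode a1 * b * a3))
   (hom_act m a2 ⊗ p) ⊗ q).
  rewrite cofree_act_tens linear_sweedler; apply: eq_sweedler => a1 x.
  by rewrite linear_sweedler; apply: eq_sweedler => a2 a3; rewrite tliftE.
rewrite (sw3_comulS (f := fun p q r => (hom_act m p ⊗ q) ⊗ r)); try lin.
under [RHS]eq_sweedler do under eq_sweedler do (rewrite sw_cofree_coact; try lin).
under [RHS]eq_sweedler do rewrite sw_exchange.
rewrite [RHS]sw_exchange; apply: eq_sweedler => b1 b2.
apply: eq_sweedler => a1 x; apply: eq_sweedler => a2 a3.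
rewrite cofree_act_tens (sw_push _ _ (f := fun u => u ⊗ _)); try lin.
by apply: eq_sweedler => c1 y; rewrite (sw_push _ _ (f := fun u => u ⊗ _)); try lin.
Qed.

(** The cofree object on the vector space [W], right adjoint to the forgetful functor: first
    coinduce to the A-module Hom(A, W), then tensor with A. Extending a linear map and lifting it
    back makes it injective, which supplies the resolutions that Ext refers to. *)
Definition cofree : ydmodule A :=
  @YDModule k A cofree_comodule cofree_act cofree_act_bilinear cofree_act1 cofree_actM
    cofree_compat.

Lemma cofree_eval_bilinear :
  bilinear_map (fun (m : M) (b : A) => counit b *: lhom_app m 1).
Proof. have hb := lhom_app_bilinear A W; lin. Qed.

Definition cofree_eval : {linear cofree -> W} := tlift cofree_eval_bilinear.

Section Lift.
Variables (X : ydmodule A) (p : {linear X -> W}).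

Lemma act_hom_linear x : linear (fun a => p (yd_act x a)).
Proof. lin. Qed.

Lemma act_hom_linear2 : linear (fun x => lhom_mk (act_hom_linear x) : M).
Proof.
have [h h'] := lhom_app_bilinear A W.
move=> c x y; apply: lhom_ext => a; rewrite h !lhom_mkE.
by rewrite (yd_act_bilinear X).1 linearP.
Qed.

Definition act_hom : {linear X -> M} := linear_of act_hom_linear2.

Lemma act_homE x a : lhom_app (act_hom x) a = p (yd_act x a).
Proof. by []. Qed.

Lemma cofree_lift_linear :
  linear (fun x => \sw_(x0, x1 <- coact x) act_hom x0 ⊗ x1 : cofree).
Proof. lin. Qed.

Definition cofree_lift_lin : {linear X -> cofree} := linear_of cofree_lift_linear.

Lemma cofree_lift_linE x :
  cofree_lift_lin x = \sw_(x0, x1 <- coact x) act_hom x0 ⊗ x1.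
Proof. by []. Qed.

Lemma cofree_lift_act x a :
  cofree_lift_lin (yd_act x a) = yd_act (cofree_lift_lin x) a.
Proof.
have hc := cofree_act_bilinear.
rewrite !cofree_lift_linE sw_coact_act; try lin.
rewrite [RHS](sw_push _ _ (f := fun u => cofree_act u a)); try lin.
apply: eq_sweedler => x0 x1; rewrite cofree_act_tens.
apply: eq_sweedler => a1 y; apply: eq_sweedler => a2 a3.
congr (_ ⊗ _); apply: lhom_ext => b.
by rewrite [RHS]lhom_mkE !act_homE yd_actM.
Qed.

Lemma cofree_lift_coact x :
  coact (cofree_lift_lin x) = \sw_(x0, x1 <- coact x) cofree_lift_lin x0 ⊗ x1.
Proof.
rewrite cofree_lift_linE linear_sweedler.
under [LHS]eq_sweedler do rewrite [coact _]tliftE.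
rewrite -coact_coassoc; try lin.
apply: eq_sweedler => x0 x1.
by rewrite cofree_lift_linE (sw_push _ _ (f := fun u => u ⊗ _)); try lin.
Qed.

Definition cofree_lift : ydhom X cofree := YDHom cofree_lift_act cofree_lift_coact.

Lemma cofree_eval_lift x : cofree_eval (cofree_lift x) = p x.
Proof.
rewrite [cofree_lift x]cofree_lift_linE linear_sweedler.
under_sw ltac:(rewrite tliftE act_homE yd_act1).
by rewrite (sw_coact_counit (f := p)); try lin.
Qed.

End Lift.

Lemma cofree_act_eval m b a :
  cofree_eval (cofree_act (m ⊗ b) a) = counit b *: lhom_app m a.
Proof.
have hb := lhom_app_bilinear A W.
rewrite cofree_act_tens linear_sweedler.
under_sw ltac:(rewrite linear_sweedler; under_sw ltac:(rewrite tliftE lhom_mkE mulr1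
  !counitM counit_antipode -!scalerA)).
under_sw ltac:(rewrite -[LHS]sw_scale -[X in _ *: X]sw_scale
  (sw_counitr (f := fun u => lhom_app m u)); try lin).
by rewrite (sw_counitl (f := fun u => counit b *: lhom_app m u)); try lin.
Qed.

Lemma cofree_lift_eval (X : ydmodule A) (f : ydhom X cofree) x :
  cofree_lift (cofree_eval \o f) x = f x.
Proof.
have hb := lhom_app_bilinear A W.
pose g : ydhom cofree cofree := cofree_lift cofree_eval.
(* Naturality of the lift reduces uniqueness to the identity of the cofree module, where it can be
   checked on pure tensors. *)
transitivity (g (f x)).
  rewrite [LHS]cofree_lift_linE [RHS]cofree_lift_linE ydhom_coact sw_sw; try lin.
  apply: eq_sweedler => x0 x1; rewrite sweedler_tens; try lin.
  by congr (_ ⊗ _); apply: lhom_ext => a; rewrite !act_homE -(ydhom_act f).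
move: (f x) => t; move: t; apply: tensor_ext => [||m b]; try lin.
rewrite [LHS]cofree_lift_linE sw_cofree_coact; try lin.
rewrite -[RHS](sw_counitl (f := fun u => m ⊗ u)); try lin.
apply: eq_sweedler => b1 b2; rewrite -[RHS]/((counit b1 : k) *: (m ⊗ b2)) -tensZl; congr (_ ⊗ _).
apply: lhom_ext => a; rewrite act_homE [yd_act _ _]/(cofree_act _ _) cofree_act_eval.
by rewrite (linearZ_of _ _ (hb.1 a)).
Qed.

Lemma cofree_injective : yd_injective cofree.
Proof.
move=> X Y i f ii; have [p pE] := linear_extend (cofree_eval \o f) ii.
exists (cofree_lift p) => x; rewrite -(cofree_lift_eval f).
rewrite [LHS]cofree_lift_linE [RHS]cofree_lift_linE ydhom_coact sw_sw; try lin.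
apply: eq_sweedler => x0 x1; rewrite sweedler_tens; try lin.
by congr (_ ⊗ _); apply: lhom_ext => a; rewrite !act_homE -ydhom_act pE.
Qed.

End Cofree.

Section InjectiveResolution.
Variables (k : fieldType) (A : hopfAlgType k).

(** Replaces the cokernel of [u]. A linear [p] whose kernel is the image of [u] is lifted to a
    morphism; the lift still kills that image, which is stable under the action and the coaction. *)
Lemma cofree_exact (X Y : ydmodule A) (u : ydhom X Y) :
  exists d : ydhom Y (cofree A Y), forall y, d y = 0 <-> exists x, y = u x.
Proof.
have [p pP] := linear_ker u; exists (cofree_lift p) => y; split=> [d0|[x ->]].
  by apply/pP; rewrite -cofree_eval_lift d0 linear0.
have e z : act_hom p (u z) = 0.
  apply: lhom_ext => a; rewrite act_homE -ydhom_act.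
  rewrite (linear0_of ((lhom_app_bilinear A Y).1 a)).
  by apply/pP; exists (yd_act z a).
rewrite [LHS]cofree_lift_linE ydhom_coact sw_sw; try lin.
apply: big1 => q _; rewrite sweedler_tens; try lin.
by rewrite e -[0](scale0r 0) tensZl !scale0r.
Qed.

Definition cofree_next (X Y : ydmodule A) (u : ydhom X Y) : ydhom Y (cofree A Y) :=
  projT1 (cid (cofree_exact u)).

Lemma cofree_nextP (X Y : ydmodule A) (u : ydhom X Y) y :
  cofree_next u y = 0 <-> exists x, y = u x.
Proof. exact: (projT2 (cid (cofree_exact u))). Qed.

Variable V : ydmodule A.

Definition cofree_aug : ydhom V (cofree A V) := cofree_lift (idfun : {linear V -> V}).

(** The recursion carries a whole arrow, since the next term and differential depend on it. The n-th
    arrow ends at the n-th term of the resolution and starts at the previous one, or at [V] when n =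
    0. *)
Fixpoint cofree_arrow (n : nat) : {X : ydmodule A & {Y : ydmodule A & ydhom X Y}} :=
  match n with
  | 0 => existT _ V (existT _ (cofree A V) cofree_aug)
  | m.+1 =>
      let s := cofree_arrow m in
      existT _ (projT1 (projT2 s)) (existT _ _ (cofree_next (projT2 (projT2 s))))
  end.

Lemma cofree_aug_inj : injective cofree_aug.
Proof. by apply: (can_inj (g := @cofree_eval k A V)) => x; rewrite cofree_eval_lift. Qed.

Lemma cofree_arrow_injective n : yd_injective (projT1 (projT2 (cofree_arrow n))).
Proof. by case: n => [|n]; exact: cofree_injective. Qed.

Definition cofree_resolution : yd_injective_resolution V :=
  @YDInjectiveResolution k A V (fun n => projT1 (projT2 (cofree_arrow n)))
    cofree_aug (fun n => cofree_next (projT2 (projT2 (cofree_arrow n))))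
    cofree_arrow_injective cofree_aug_inj
    (cofree_nextP cofree_aug)
    (fun n => cofree_nextP (projT2 (projT2 (cofree_arrow n.+1)))).

End InjectiveResolution.

(** * Ext through syzygies *)


Section YDHoms.
Variables (k : fieldType) (A : hopfAlgType k).
Implicit Types X Y Z : ydmodule A.

Definition ydcomp X Y Z (g : ydhom Y Z) (f : ydhom X Y) : ydhom X Z.
Proof.
refine (@YDHom k A X Z (g \o f) _ _) => [v a|v] /=.
  by rewrite !ydhom_act.
abstract (rewrite !ydhom_coact sw_sw; try lin;
  by apply: eq_sweedler => v0 v1; rewrite sweedler_tens; try lin).
Defined.

Lemma ydsub_linear X Y (f g : ydhom X Y) : linear (fun x => f x - g x).
Proof. lin. Qed.

Definition ydsub X Y (f g : ydhom X Y) : ydhom X Y.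
Proof.
refine (@YDHom k A X Y (linear_of (ydsub_linear f g)) _ _) => [v a|v] /=.
  abstract (by rewrite !ydhom_act -(linearB (linear_of ((yd_act_bilinear Y).1 a)))).
abstract (rewrite linearB !ydhom_coact -sumrB; apply: eq_bigr => q _; by rewrite tensBl).
Defined.

Lemma ydcompE X Y Z (g : ydhom Y Z) (f : ydhom X Y) x : ydcomp g f x = g (f x).
Proof. by []. Qed.

Lemma ydsubE X Y (f g : ydhom X Y) x : ydsub f g x = f x - g x.
Proof. by []. Qed.

Lemma mono_lift X Y V (m : ydhom V Y) (f : ydhom X Y) : injective m ->
  (forall x, exists v, f x = m v) -> exists g : ydhom X V, forall x, m (g x) = f x.
Proof.
move=> mi fm; have [s ms] := linear_ginv m.
have msf x : m (s (f x)) = f x by have [v ->] := fm x.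
have sm v : s (m v) = v by apply: mi.
have g_act x a : s (f (yd_act x a)) = yd_act (s (f x)) a.
  by apply: mi; rewrite msf !ydhom_act msf.
have g_coact x : coact ((s \o f) x) = \sw_(x0, x1 <- coact x) (s \o f) x0 ⊗ x1.
  transitivity (\sw_(v, a <- coact (m (s (f x)))) s v ⊗ a).
    rewrite ydhom_coact sw_sw; try lin.
    rewrite [LHS]tensorE; apply: eq_sweedler => v a.
    by rewrite sweedler_tens ?sm; try lin.
  rewrite msf ydhom_coact sw_sw; try lin.
  by apply: eq_sweedler => v a; rewrite sweedler_tens; try lin.
by exists (@YDHom k A X V (s \o f) g_act g_coact).
Qed.

Lemma free_factor X Z (g : ydhom (free_yd X) Z) :
  (forall x, g (syz_in X x) = 0) ->
  exists u : ydhom X Z, forall t, g t = u (free_counit X t).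
Proof.
move=> g0.
have gE t : g t = g (free_unit X (free_counit X t)).
  by apply/eqP; rewrite -subr_eq0 -linearB -syz_in_proj g0.
have u_act x a : g (free_unit X (yd_act x a)) = yd_act (g (free_unit X x)) a.
  by rewrite -{1}[x]free_unitK -(ydhom_act (free_counit X)) -gE ydhom_act.
have u_coact x : coact ((g \o free_unit X) x) =
    \sw_(x0, x1 <- coact x) (g \o free_unit X) x0 ⊗ x1.
  rewrite [LHS](ydhom_coact g) free_unit_colinear sw_sw; try lin.
  by apply: eq_sweedler => x0 x1; rewrite sweedler_tens; try lin.
by exists (@YDHom k A X Z (g \o free_unit X) u_act u_coact) => t /=.
Qed.

End YDHoms.

Section Balance.
Variables (k : fieldType) (A : hopfAlgType k).
Hypothesis A_cosemisimple : cosemisimple A.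

Lemma free_yd_projective (V : comodule A) (X Y : ydmodule A)
    (f : ydhom (free_yd V) Y) (g : ydhom X Y) :
  (forall t, exists x, f t = g x) ->
  exists l : ydhom (free_yd V) X, forall t, g (l t) = f t.
Proof.
have [h [h1 hinv]] := haar_functional A_cosemisimple.
exact: free_projective h1 hinv _ _ _ _ _.
Qed.

Variables (V : ydmodule A) (I : yd_injective_resolution V).
Implicit Types X : ydmodule A.

(** The injective resolution [I] stays fixed while the first argument is replaced by its
    syzygies. *)
Definition ext_neq0 n X :=
  exists f : ydhom X (ires_obj I n), ires_cocycle f /\ ~ ires_coboundary f.

(** Dimension shifting along syz X -> X ⊠ A -> X. A cocycle pulled back to the projective X ⊠ A is a
    coboundary of some [g], and [g] restricted to the syzygy is the new cocycle; if that one bounds,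
    injectivity extends the bounding map and corrects [g] to bound [f]. *)
Lemma ext_syz_down n X : ext_neq0 n.+2 X -> ext_neq0 n.+1 (syz X).
Proof.
move=> [f [fc fnb]].
have [t|g gE] := @free_yd_projective X _ _ (ydcomp f (free_counit X)) (ires_d I n.+1).
  exact/ires_exactS/fc.
exists (ydcomp g (syz_in X)); split=> [x|[u uE]].
  by rewrite ydcompE gE ydcompE free_counit_syz linear0.
have [u' u'E] := @ires_injective _ _ _ I n _ _ (syz_in X) u (@syz_in_inj _ _ X).
have [x|w wE] := @free_factor _ _ X _ (ydsub g (ydcomp (ires_d I n) u')).
  by rewrite ydsubE !ydcompE u'E -uE ydcompE subrr.
apply: fnb; exists w => x.
rewrite -[x in LHS]free_unitK -[x in RHS]free_unitK -wE ydsubE ydcompE linearB.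
rewrite (_ : ires_d I n.+1 (ires_d I n _) = 0); last by apply/ires_exactS; eexists.
by rewrite subr0 gE.
Qed.

Lemma ext_syz_up n X : ext_neq0 n.+1 (syz X) -> ext_neq0 n.+2 X.
Proof.
move=> [f [fc fnb]].
have [g gE] := @ires_injective _ _ _ I n.+1 _ _ (syz_in X) f (@syz_in_inj _ _ X).
have [x|u uE] := @free_factor _ _ X _ (ydcomp (ires_d I n.+1) g).
  by rewrite ydcompE gE fc.
exists u; split=> [x|[w wE]].
  by rewrite -[x]free_unitK -uE; apply/ires_exactS; eexists.
apply: fnb.
have [t|l lE] := @free_yd_projective X _ _ (ydsub g (ydcomp w (free_counit X))) (ires_d I n).
  by apply/ires_exactS; rewrite ydsubE ydcompE linearB -wE -uE ydcompE subrr.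
exists (ydcomp l (syz_in X)) => x.
by rewrite ydcompE lE ydsubE ydcompE free_counit_syz linear0 subr0 gE.
Qed.

(** In degree one the augmentation replaces the lower differential, so the restricted map lands in
    [V] itself. *)
Lemma ext1_down X : ext_neq0 1 X ->
  exists f : ydhom (syz X) V,
    ~ exists g : ydhom (free_yd X) V, forall x, g (syz_in X x) = f x.
Proof.
move=> [f [fc fnb]].
have [t|g gE] := @free_yd_projective X _ _ (ydcomp f (free_counit X)) (ires_d I 0).
  exact/ires_exactS/fc.
have [x|u uE] := mono_lift (f := ydcomp g (syz_in X)) (@ires_aug_inj _ _ _ I).
  by apply/ires_exact0; rewrite ydcompE gE ydcompE free_counit_syz linear0.
exists u => -[u' u'E]; apply: fnb.
have [x|w wE] := @free_factor _ _ X _ (ydsub g (ydcomp (ires_aug I) u')).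
  by rewrite ydsubE !ydcompE u'E uE ydcompE subrr.
exists w => x.
rewrite -[x in LHS]free_unitK -[x in RHS]free_unitK -wE ydsubE ydcompE linearB.
rewrite (_ : ires_d I 0 (ires_aug I _) = 0); last by apply/ires_exact0; eexists.
by rewrite subr0 gE.
Qed.

Lemma ext1_up X (f : ydhom (syz X) V) :
  ~ (exists g : ydhom (free_yd X) V, forall x, g (syz_in X x) = f x) ->
  ext_neq0 1 X.
Proof.
move=> fne.
have [g gE] := @ires_injective _ _ _ I 0 _ _ (syz_in X) (ydcomp (ires_aug I) f)
  (@syz_in_inj _ _ X).
have [x|u uE] := @free_factor _ _ X _ (ydcomp (ires_d I 0) g).
  by rewrite ydcompE gE; apply/ires_exact0; eexists.
exists u; split=> [x|[w wE]].
  by rewrite -[x]free_unitK -uE; apply/ires_exactS; eexists.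
apply: fne.
have [t|l lE] := mono_lift (f := ydsub g (ydcomp w (free_counit X))) (@ires_aug_inj _ _ _ I).
  by apply/ires_exact0; rewrite ydsubE ydcompE linearB -wE -uE ydcompE subrr.
exists l => x; apply: (@ires_aug_inj _ _ _ I).
by rewrite lE ydsubE ydcompE free_counit_syz linear0 subr0 gE.
Qed.

Fixpoint syzn n X : ydmodule A := if n is m.+1 then syz (syzn m X) else X.

Lemma ext_syzn i n X : ext_neq0 (n + i).+1 X <-> ext_neq0 n.+1 (syzn i X).
Proof.
elim: i n => [|i IH] n; first by rewrite addn0.
rewrite addnS -addSn IH; split; [exact: ext_syz_down|exact: ext_syz_up].
Qed.

Lemma ext_down n X : ext_neq0 n.+1 X ->
  exists f : ydhom (syzn n.+1 X) V,
    ~ exists g : ydhom (free_yd (syzn n X)) V, forall x, g (syz_in (syzn n X) x) = f x.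
Proof. by move=> /(ext_syzn n 0)/ext1_down. Qed.

Lemma ext_up n X (f : ydhom (syzn n.+1 X) V) :
  ~ (exists g : ydhom (free_yd (syzn n X)) V, forall x, g (syz_in (syzn n X) x) = f x) ->
  ext_neq0 n.+1 X.
Proof. by move=> /ext1_up h; apply/(ext_syzn n 0). Qed.

End Balance.

(** * Bimodules induced from Yetter-Drinfeld modules *)


Section BimodHoms.
Variables (k : fieldType) (A : algType k).
Implicit Types M N Q : bimodule A.

Definition bimodcomp M N Q (g : bimodhom N Q) (f : bimodhom M N) : bimodhom M Q.
Proof.
by refine (@BimodHom k A M Q (g \o f) _ _) => [a m|m a] /=;
  rewrite ?bimodhom_lact ?bimodhom_ract.
Defined.

Lemma bimodcompE M N Q (g : bimodhom N Q) (f : bimodhom M N) x :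
  bimodcomp g f x = g (f x).
Proof. by []. Qed.

Definition bimodid M : bimodhom M M :=
  @BimodHom k A M M idfun (fun _ _ => erefl) (fun _ _ => erefl).

Lemma bimodsub_linear M N (f g : bimodhom M N) : linear (fun x => f x - g x).
Proof. lin. Qed.

Definition bimodsub M N (f g : bimodhom M N) : bimodhom M N.
Proof.
refine (@BimodHom k A M N (linear_of (bimodsub_linear f g)) _ _) => [a m|m a] /=.
  by rewrite !bimodhom_lact -(linearB (linear_of ((lact_bilinear N).2 a))).
by rewrite !bimodhom_ract -(linearB (linear_of ((ract_bilinear N).1 a))).
Defined.

Lemma bimodsubE M N (f g : bimodhom M N) x : bimodsub f g x = f x - g x.
Proof. by []. Qed.

Definition zero_bimodule : bimodule A.
Proof.
refine (@Bimodule k A ('rV[k]_0) (fun _ _ => 0) (fun _ _ => 0) _ _ _ _ _ _ _) => //.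
- by split=> ? ? ? ?; rewrite scaler0 addr0.
- by split=> ? ? ? ?; rewrite scaler0 addr0.
- by move=> m; rewrite [RHS]thinmx0.
- by move=> m; rewrite [RHS]thinmx0.
Defined.

Lemma zero_bimoduleE (x : zero_bimodule) : x = 0.
Proof. exact: (thinmx0 x). Qed.

Lemma zero_map_linear M N : linear (fun _ : M => 0 : N).
Proof. by move=> c x y; rewrite scaler0 addr0. Qed.

Definition zero_bimodhom M N : bimodhom M N.
Proof.
refine (@BimodHom k A M N (linear_of (@zero_map_linear M N)) _ _) => [a m|m a] /=.
  by rewrite (linear0_of ((lact_bilinear N).2 a)).
by rewrite (linear0_of ((ract_bilinear N).1 a)).
Defined.

Lemma zero_bimodule_projective : bimod_projective zero_bimodule.
Proof.
move=> X Y p f _; exists (zero_bimodhom _ _) => x.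
by rewrite (zero_bimoduleE x) !linear0.
Qed.

End BimodHoms.

Section Induced.
Variables (k : fieldType) (A : hopfAlgType k).
Implicit Types X Y : ydmodule A.

Section Object.
Variable X : ydmodule A.

Definition ind_lact (a : A) (t : tensor A X) : tensor A X := \sw_(b, x <- t) (a * b) ⊗ x.

Lemma ind_lact_bilinear : bilinear_map ind_lact.
Proof. rewrite /ind_lact; lin. Qed.

Lemma ind_lact_tens a b (x : X) : ind_lact a (b ⊗ x) = (a * b) ⊗ x.
Proof. by rewrite /ind_lact sweedler_tens; try lin. Qed.

Definition ind_ract (t : tensor A X) (c : A) : tensor A X :=
  \sw_(b, x <- t) \sw_(c1, c2 <- comul c) (b * c1) ⊗ yd_act x c2.

Lemma ind_ract_bilinear : bilinear_map ind_ract.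
Proof. rewrite /ind_ract; lin. Qed.

Lemma ind_ract_tens b (x : X) c :
  ind_ract (b ⊗ x) c = \sw_(c1, c2 <- comul c) (b * c1) ⊗ yd_act x c2.
Proof. by rewrite /ind_ract sweedler_tens; try lin. Qed.

Lemma ind_lact1 t : ind_lact 1 t = t.
Proof.
have hl := ind_lact_bilinear.
by move: t; apply: tensor_ext => [||b x]; try lin; rewrite ind_lact_tens mul1r.
Qed.

Lemma ind_ract1 t : ind_ract t 1 = t.
Proof.
have hl := ind_ract_bilinear.
move: t; apply: tensor_ext => [||b x]; try lin.
by rewrite ind_ract_tens sw_comul1 ?mulr1 ?yd_act1; try lin.
Qed.

Lemma ind_lactM a b t : ind_lact (a * b) t = ind_lact a (ind_lact b t).
Proof.
have hl := ind_lact_bilinear.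
by move: t; apply: tensor_ext => [||c x]; try lin; rewrite !ind_lact_tens mulrA.
Qed.

Lemma ind_ractM t a b : ind_ract t (a * b) = ind_ract (ind_ract t a) b.
Proof.
have hl := ind_ract_bilinear.
move: t; apply: tensor_ext => [||c x]; try lin.
rewrite !ind_ract_tens sw_comulM; try lin.
rewrite (sw_push _ _ (f := fun u => ind_ract u b)); try lin.
apply: eq_sweedler => a1 a2; rewrite ind_ract_tens.
by apply: eq_sweedler => b1 b2; rewrite mulrA yd_actM.
Qed.

Lemma ind_lractA a t b : ind_ract (ind_lact a t) b = ind_lact a (ind_ract t b).
Proof.
have hl := ind_lact_bilinear; have hr := ind_ract_bilinear.
move: t; apply: tensor_ext => [||c x]; try lin.
rewrite ind_lact_tens !ind_ract_tens (sw_push _ _ (f := ind_lact a)); try lin.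
by apply: eq_sweedler => b1 b2; rewrite ind_lact_tens mulrA.
Qed.

Definition ind : bimodule A :=
  @Bimodule k A (tensor A X) ind_lact ind_ract ind_lact_bilinear ind_ract_bilinear
    ind_lact1 ind_ract1 ind_lactM ind_ractM ind_lractA.

(* The identity S(a_1) (1 ⊗ x) a_2 = 1 ⊗ x a makes b ⊗ x |-> b f(x) the bimodule map
   attached to a linear f with f(x a) = S(a_1) f(x) a_2. *)
Lemma ind_adjoint (x : X) a :
  \sw_(a1, a2 <- comul a) ind_ract (ind_lact (antipode a1) (1 ⊗ x)) a2 = 1 ⊗ yd_act x a.
Proof.
transitivity (\sw3_(a1, a2, a3 <- a) (antipode a1 * a2) ⊗ yd_act x a3).
  apply: eq_sweedler => a1 y; rewrite ind_lact_tens ind_ract_tens.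
  by apply: eq_sweedler => a2 a3; rewrite mulr1.
by rewrite (sw_antipodelK (f := fun p q => p ⊗ yd_act x q)); try lin.
Qed.

Section Lift.
Variables (N : bimodule A) (f : {linear X -> N}).
Hypothesis f_act : forall x a,
  f (yd_act x a) = \sw_(a1, a2 <- comul a) ract (lact (antipode a1) (f x)) a2.

Lemma ind_lift_bilinear : bilinear_map (fun (b : A) (x : X) => lact b (f x)).
Proof. lin. Qed.

Let g : {linear tensor A X -> N} := tlift ind_lift_bilinear.

Lemma ind_lift_lact a (t : ind) : g (lact a t) = lact a (g t).
Proof.
have hl := ind_lact_bilinear.
move: t; apply: tensor_ext => [||b x]; try lin.
by rewrite [lact a _]ind_lact_tens /g !tliftE lactM.
Qed.

Lemma ind_lift_ract (t : ind) a : g (ract t a) = ract (g t) a.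
Proof.
have hr := ind_ract_bilinear.
move: t; apply: tensor_ext => [||b x]; try lin.
rewrite [ract _ a]ind_ract_tens linear_sweedler /g tliftE.
under_sw ltac:(rewrite tliftE f_act (sw_push _ _ (f := fun u => lact _ u)); try lin;
   under_sw ltac:(rewrite -lractA -lactM)).
have := @sw_antipoderK _ _ N (fun p q => ract (lact (b * p) (f x)) q) a.
rewrite mulr1 => <-; try lin.
by apply: eq_sweedler => a1 y; apply: eq_sweedler => a2 a3; rewrite mulrA.
Qed.

Definition ind_lift : bimodhom ind N := @BimodHom k A ind N g ind_lift_lact ind_lift_ract.

Lemma ind_liftE b x : ind_lift (b ⊗ x) = lact b (f x).
Proof. exact: tliftE. Qed.

End Lift.
End Object.
End Induced.

(** * Lifting and comparison of bimodule resolutions *)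


Section IndMap.
Variables (k : fieldType) (A : hopfAlgType k).
Implicit Types X Y Z : ydmodule A.

Lemma ind_map_act X Y (f : {linear X -> Y}) :
  (forall x a, f (yd_act x a) = yd_act (f x) a) ->
  forall x a, linear_of ((tens_bilinear A Y).2 1 : linear (tens (1 : A))) (f (yd_act x a)) =
   \sw_(a1, a2 <- comul a) @ract _ _ (ind Y) (lact (antipode a1) (1 ⊗ f x : ind Y)) a2.
Proof. by move=> hf x a; rewrite /= hf -ind_adjoint. Qed.

Definition ind_map X Y (f : {linear X -> Y})
    (hf : forall x a, f (yd_act x a) = yd_act (f x) a) : bimodhom (ind X) (ind Y) :=
  @ind_lift k A X (ind Y) (linear_of ((tens_bilinear A Y).2 1 : linear (tens (1 : A))) \o f)
    (ind_map_act hf).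

Lemma ind_mapE X Y (f : {linear X -> Y}) hf b x :
  @ind_map X Y f hf (b ⊗ x) = b ⊗ f x.
Proof. by rewrite [LHS]ind_liftE [LHS]ind_lact_tens mulr1. Qed.

Section FreeAd.
Variables (V : comodule A) (N : bimodule A) (f : {linear V -> N}).

Lemma free_ad_bilinear : bilinear_map (fun (v : V) (a : A) =>
  \sw_(a1, a2 <- comul a) ract (lact (antipode a1) (f v)) a2).
Proof. lin. Qed.

Definition free_ad : {linear free_yd V -> N} := tlift free_ad_bilinear.

Lemma free_adE v a :
  free_ad (v ⊗ a) = \sw_(a1, a2 <- comul a) ract (lact (antipode a1) (f v)) a2.
Proof. exact: tliftE. Qed.

Lemma free_ad_act t a : free_ad (yd_act t a) =
  \sw_(a1, a2 <- comul a) ract (lact (antipode a1) (free_ad t)) a2.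
Proof.
have hb := free_act_bilinear V.
move: t; apply: tensor_ext => [||v c]; try lin.
rewrite [yd_act _ a]free_act_tens !free_adE sw_comulM; try lin.
rewrite sw_exchange; apply: eq_sweedler => a1 a2.
rewrite (sw_push _ _ (f := fun u => ract (lact (antipode a1) u) a2)); try lin.
by apply: eq_sweedler => c1 c2; rewrite antipodeM lactM ractM -!lractA.
Qed.

(** Here [f] is an arbitrary linear map: A ⊗ (V ⊠ A) is the free bimodule on the vector space
    [V]. *)
Definition free_bimod_lift : bimodhom (ind (free_yd V)) N := ind_lift free_ad_act.

Lemma free_bimod_liftE b v a : free_bimod_lift (b ⊗ (v ⊗ a)) =
  lact b (\sw_(a1, a2 <- comul a) ract (lact (antipode a1) (f v)) a2).
Proof. by rewrite ind_liftE free_adE. Qed.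

End FreeAd.

Lemma ind_free_lift (V : comodule A) (X Y : bimodule A)
    (f : bimodhom (ind (free_yd V)) Y) (g : bimodhom X Y) :
  (forall t, exists x, f t = g x) ->
  exists l : bimodhom (ind (free_yd V)) X, forall t, g (l t) = f t.
Proof.
move=> fg.
have lf0 : linear (fun v : V => f (1 ⊗ (v ⊗ 1))) by lin.
have [g0 gg0] : exists g0 : {linear V -> X}, forall v, g (g0 v) = linear_of lf0 v.
  by apply: linear_lift => v; apply: fg.
exists (free_bimod_lift g0) => t.
move: t; apply: tensor_ext => [||b t]; try lin.
have lb := tens_bilinear A (free_yd V).
move: t; apply: tensor_ext => [||v a]; try lin.
rewrite free_bimod_liftE bimodhom_lact linear_sweedler.
transitivity (lact b (f (1 ⊗ yd_act (v ⊗ 1 : free_yd V) a))).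
  congr (lact b _); rewrite -ind_adjoint linear_sweedler; apply: eq_sweedler => a1 a2.
  by rewrite bimodhom_ract bimodhom_lact gg0 -bimodhom_lact -bimodhom_ract.
rewrite -bimodhom_lact [yd_act _ a]free_act_tens mul1r.
by rewrite [lact b _]ind_lact_tens mulr1.
Qed.

Lemma ind_free_projective (V : comodule A) : bimod_projective (ind (free_yd V)).
Proof.
move=> X Y p f ps; apply: ind_free_lift => t.
by have [x <-] := ps (f t); exists x.
Qed.

Section TrivialComodule.
Variable W : lmodType k.

Definition triv_comod_coact : {linear W -> tensor W A} :=
  linear_of ((tens_bilinear W A).1 1).

Lemma triv_comod_coactA w :
  \sw_(x, v2 <- triv_comod_coact w) \sw_(v0, v1 <- triv_comod_coact x) v0 ⊗ (v1 ⊗ v2) =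
  \sw_(v0, x <- triv_comod_coact w) v0 ⊗ comul x.
Proof. by rewrite /= !sweedler_tens ?comul1; try lin. Qed.

Lemma triv_comod_counit w : \sw_(v0, v1 <- triv_comod_coact w) counit v1 *: v0 = w.
Proof. by rewrite /= sweedler_tens ?rmorph1 ?scale1r; try lin. Qed.

(** Allows the free bimodule on any vector space, such as the one underlying a bimodule, to be
    written A ⊗ (W ⊠ A). *)
Definition triv_comod : comodule A :=
  @Comodule k A W triv_comod_coact triv_comod_coactA triv_comod_counit.

End TrivialComodule.

(* A projective bimodule is a retract of a free one, so it lifts along maps whose image
   merely contains the image of the given map. *)
Lemma projective_lift (P X Y : bimodule A) (f : bimodhom P Y) (g : bimodhom X Y) :
  bimod_projective P -> (forall t, exists x, f t = g x) ->
  exists l : bimodhom P X, forall t, g (l t) = f t.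
Proof.
move=> Pproj fg.
pose F := @free_bimod_lift (triv_comod P) P (idfun : {linear P -> P}).
have [m|s sE] := Pproj _ _ F (bimodid P).
  exists (1 ⊗ (m ⊗ 1)); rewrite free_bimod_liftE lact1 sw_comul1; try lin.
  by rewrite antipode1 lact1 ract1.
have [t|l lE] := @ind_free_lift _ X Y (bimodcomp f F) g; first exact: fg.
by exists (bimodcomp l s) => t; rewrite bimodcompE lE bimodcompE sE.
Qed.

End IndMap.

Section Comparison.
Variables (k : fieldType) (A : hopfAlgType k) (M : bimodule A).
Variables (P Q : bimod_projective_resolution M).
Local Notation d := (pres_d P).
Local Notation e := (pres_d Q).

(* Comparison maps u : P_n -> Q_n and v : Q_n -> P_n together with a homotopy s between
   the identity and v u; the condition at n involves no choices below n. *)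
Let homotopy_at n := exists (u : bimodhom (pres_obj P n) (pres_obj Q n))
    (v : bimodhom (pres_obj Q n) (pres_obj P n))
    (s : bimodhom (pres_obj P n) (pres_obj P n.+1)),
  [/\ forall x, exists y, u (d n x) = e n y,
      forall x, exists y, v (e n x) = d n y &
      forall x, d n x - v (u (d n x)) - d n (s (d n x)) = 0].

Lemma homotopy_exists0 : homotopy_at 0.
Proof.
have [x|u uE] := projective_lift (f := pres_aug P) (g := pres_aug Q) (@pres_projective _ _ _ P 0).
  by have [y <-] := pres_aug_surj Q (pres_aug P x); exists y.
have [x|v vE] := projective_lift (f := pres_aug Q) (g := pres_aug P) (@pres_projective _ _ _ Q 0).
  by have [y <-] := pres_aug_surj P (pres_aug Q x); exists y.
have [x|s sE] := projective_lift (f := bimodsub (bimodid _) (bimodcomp v u)) (g := d 0)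
    (@pres_projective _ _ _ P 0).
  by apply/pres_exact0; rewrite bimodsubE linearB bimodcompE vE uE subrr.
exists u, v, s; split=> x.
- by apply/pres_exact0; rewrite uE; apply/pres_exact0; exists x.
- by apply/pres_exact0; rewrite vE; apply/pres_exact0; exists x.
- by rewrite sE subrr.
Qed.

(** The first conjunct drives the induction. The second is read off from the same step: [s] becomes
    the previous homotopy [s'], and the new one is a lift through the next differential. *)
Lemma homotopy_exists n : homotopy_at n.+1 /\
  exists (u : bimodhom (pres_obj P n.+1) (pres_obj Q n.+1))
    (v : bimodhom (pres_obj Q n.+1) (pres_obj P n.+1))
    (s : bimodhom (pres_obj P n.+1) (pres_obj P n.+2))
    (s' : bimodhom (pres_obj P n) (pres_obj P n.+1)),
    forall x, d n.+1 (s x) = x - v (u x) - s' (d n x).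
Proof.
suff step m : homotopy_at m -> homotopy_at m.+1 /\
  exists (u : bimodhom (pres_obj P m.+1) (pres_obj Q m.+1))
    (v : bimodhom (pres_obj Q m.+1) (pres_obj P m.+1))
    (s : bimodhom (pres_obj P m.+1) (pres_obj P m.+2))
    (s' : bimodhom (pres_obj P m) (pres_obj P m.+1)),
    forall x, d m.+1 (s x) = x - v (u x) - s' (d m x).
  by elim: n => [|n [IH _]]; apply: step => //; apply: homotopy_exists0.
move=> [u [v [s [uP vP sP]]]].
have dd x : d m (d m.+1 x) = 0 by apply/pres_exactS; exists x.
have ee x : e m (e m.+1 x) = 0 by apply/pres_exactS; exists x.
have [x|u' u'E] := projective_lift (f := bimodcomp u (d m)) (g := e m)
    (@pres_projective _ _ _ P m.+1); first exact: uP.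
have [x|v' v'E] := projective_lift (f := bimodcomp v (e m)) (g := d m)
    (@pres_projective _ _ _ Q m.+1); first exact: vP.
have [x|s' s'E] := projective_lift
    (f := bimodsub (bimodsub (bimodid _) (bimodcomp v' u')) (bimodcomp s (d m)))
    (g := d m.+1) (@pres_projective _ _ _ P m.+1).
  apply/pres_exactS.
  rewrite !bimodsubE !bimodcompE !linearB v'E bimodcompE u'E bimodcompE.
  exact: sP.
split; last by exists u', v', s', s => x; rewrite s'E.
exists u', v', s'; split=> x.
- by apply/pres_exactS; rewrite u'E bimodcompE dd linear0.
- by apply/pres_exactS; rewrite v'E bimodcompE ee linear0.
- by rewrite s'E !bimodsubE !bimodcompE dd linear0 subr0 subrr.
Qed.

(** Every cocycle in degree n+1 of [P] is a coboundary when [Q] is 0 there: [u] vanishes, so the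
    homotopy reads x = d(s x) + s'(d x), and [g] kills the first term. *)
Lemma resolution_extend n (N : bimodule A) (g : bimodhom (pres_obj P n.+1) N) :
  (forall x : pres_obj Q n.+1, x = 0) -> (forall x, g (d n.+1 x) = 0) ->
  exists g' : bimodhom (pres_obj P n) N, forall x, g x = g' (d n x).
Proof.
move=> Q0 gd; have [_ [u [v [s [s' h]]]]] := homotopy_exists n.
exists (bimodcomp g s') => x; rewrite bimodcompE.
have := gd (s x); rewrite h (Q0 (u x)) linear0 subr0 linearB => /eqP.
by rewrite subr_eq0 => /eqP.
Qed.

End Comparison.

(** * The two inequalities *)


Section IndExact.
Variables (k : fieldType) (A : hopfAlgType k).
Implicit Types X : ydmodule A.

Definition ind_counit X : bimodhom (ind (free_yd X)) (ind X) :=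
  ind_map (ydhom_act (free_counit X)).

Definition ind_syz_in X : bimodhom (ind (syz X)) (ind (free_yd X)) :=
  ind_map (ydhom_act (syz_in X)).

Section TensorMap.
Variables (X Y : lmodType k) (f : {linear X -> Y}).
Lemma tmap_bilinear : bilinear_map (fun (b : A) (x : X) => b ⊗ f x).
Proof. lin. Qed.
(** [free_unit] and [syz_proj] are not known to be A-linear, so [ind_map] does not apply to them.
    Tensored as mere linear maps they still split the induced sequence, whence its exactness. *)
Definition tmap : {linear tensor A X -> tensor A Y} := tlift tmap_bilinear.
Lemma tmapE b x : tmap (b ⊗ x) = b ⊗ f x.
Proof. exact: tliftE. Qed.
End TensorMap.

Lemma ind_counitK X t : ind_counit X (tmap (free_unit X) t) = t.
Proof.
move: t; apply: tensor_ext => [||b x]; try lin.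
by rewrite tmapE ind_mapE free_unitK.
Qed.

Lemma ind_syz_inK X t : tmap (syz_proj X) (ind_syz_in X t) = t.
Proof.
move: t; apply: tensor_ext => [||b x]; try lin.
by rewrite ind_mapE tmapE syz_proj_in.
Qed.

Lemma ind_split X t :
  ind_syz_in X (tmap (syz_proj X) t) + tmap (free_unit X) (ind_counit X t) = t.
Proof.
move: t; apply: tensor_ext => [||b x]; try lin.
rewrite ind_mapE !tmapE ind_mapE syz_in_proj.
by rewrite -[X in X + _]scale1r -tensPr scale1r addrNK.
Qed.

Lemma ind_exact X t : ind_counit X t = 0 <-> exists y, t = ind_syz_in X y.
Proof.
split=> [t0|[y ->]].
  by exists (tmap (syz_proj X) t); rewrite -[LHS]ind_split t0 linear0 addr0.
move: y; apply: (@tensor_ext _ A (syz X) _ (fun y => ind_counit X (ind_syz_in X y)) (fun=> 0)).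
- lin.
- by move=> c x y; rewrite scaler0 addr0.
- move=> b x; rewrite !ind_mapE free_counit_syz.
  exact: (linear0_of ((tens_bilinear A X).2 b)).
Qed.

Lemma ind_syz_in_inj X : injective (ind_syz_in X).
Proof. by apply: (can_inj (g := tmap (syz_proj X))) => t; rewrite ind_syz_inK. Qed.

Lemma ind_counit_surj X t : exists s, ind_counit X s = t.
Proof. by exists (tmap (free_unit X) t); rewrite ind_counitK. Qed.

Definition ind_res_d X n :
    bimodhom (ind (free_yd (syzn n.+1 X))) (ind (free_yd (syzn n X))) :=
  bimodcomp (ind_syz_in (syzn n X)) (ind_counit (syzn n.+1 X)).

Lemma ind_res_dE X n b (t : free_yd (syzn n.+1 X)) :
  ind_res_d X n (b ⊗ t) = b ⊗ syz_in (syzn n X) (free_counit (syzn n.+1 X) t).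
Proof. by rewrite bimodcompE ind_mapE [LHS]ind_mapE. Qed.

Lemma ind_res_exact0 X t :
  ind_counit X t = 0 <-> exists y, t = ind_res_d X 0 y.
Proof.
rewrite ind_exact; split=> -[y ->]; last by eexists.
by have [s <-] := ind_counit_surj y; exists s.
Qed.

Lemma ind_res_exactS X n t :
  ind_res_d X n t = 0 <-> exists y, t = ind_res_d X n.+1 y.
Proof.
rewrite -(ind_res_exact0 (X := syzn n.+1 X)); split=> [|t0].
  by rewrite -(linear0 (ind_syz_in (syzn n X))) => /ind_syz_in_inj.
by rewrite /ind_res_d bimodcompE t0 linear0.
Qed.

Definition ind_resolution X : bimod_projective_resolution (ind X) :=
  @BimodProjectiveResolution k A (ind X) (fun n => ind (free_yd (syzn n X)))
    (ind_counit X) (ind_res_d X) (fun n => @ind_free_projective k A (syzn n X))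
    (@ind_counit_surj X) (@ind_res_exact0 X) (@ind_res_exactS X).

Lemma ind_projective_of_section X (s : ydhom X (free_yd X)) :
  (forall x, free_counit X (s x) = x) -> bimod_projective (ind X).
Proof.
move=> sE Y Z p f ps.
have [g gE] := @ind_free_projective k A X Y Z p (bimodcomp f (ind_counit X)) ps.
exists (bimodcomp g (ind_map (ydhom_act s))) => t.
rewrite bimodcompE gE bimodcompE; congr (f _).
by move: t; apply: tensor_ext => [||b x]; try lin; rewrite !ind_mapE sE.
Qed.

Definition splice_obj X (P : bimod_projective_resolution (ind (syz X))) n : bimodule A :=
  if n is m.+1 then pres_obj P m else ind (free_yd X).

Definition splice_d X (P : bimod_projective_resolution (ind (syz X))) n :
    bimodhom (splice_obj P n.+1) (splice_obj P n) :=
  match n with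
  | 0 => bimodcomp (ind_syz_in X) (pres_aug P)
  | m.+1 => pres_d P m
  end.

Lemma splice_resolution X (P : bimod_projective_resolution (ind (syz X))) :
  exists Q : bimod_projective_resolution (ind X), forall n, pres_obj Q n = splice_obj P n.
Proof.
unshelve eexists (@BimodProjectiveResolution k A (ind X) (splice_obj P)
  (ind_counit X) (splice_d P) _ (@ind_counit_surj X) _ _).
- by case=> [|n]; [exact: ind_free_projective|exact: pres_projective].
- move=> t; rewrite ind_exact; split=> -[y ->]; last by eexists.
  by have [s <-] := pres_aug_surj P y; exists s.
- case=> [|n] x; last exact: pres_exactS.
  rewrite -(pres_exact0 x) [splice_d P 0 x]bimodcompE; split=> [|->]; last exact: linear0.
  by rewrite -(linear0 (ind_syz_in X)) => /ind_syz_in_inj.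
- by [].
Qed.

Definition point_obj (M : bimodule A) n : bimodule A :=
  if n is _.+1 then zero_bimodule A else M.

Lemma point_resolution (M : bimodule A) : bimod_projective M ->
  exists Q : bimod_projective_resolution M, forall n, pres_obj Q n = point_obj M n.
Proof.
move=> Mproj.
unshelve eexists (@BimodProjectiveResolution k A M (point_obj M)
  (bimodid M) (fun n => zero_bimodhom _ _) _ _ _ _).
- by case=> [|n]; [exact: Mproj|exact: zero_bimodule_projective].
- by move=> m; exists m.
- move=> x; split=> [x0|[y ->]]; last by [].
  by exists 0.
- move=> n x; split=> [_|[y ->]]; last by [].
  by exists 0; exact: (zero_bimoduleE x).
- by [].
Qed.

Lemma syznS n X : syzn n.+1 X = syzn n (syz X).
Proof. by elim: n => //= n ->. Qed.

(** Splices the sequences A ⊗ syz -> A ⊗ free -> A ⊗ X until the projective syzygy itself can serve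
    as the last term. *)
Lemma truncated_resolution n X : bimod_projective (ind (syzn n X)) ->
  exists P : bimod_projective_resolution (ind X),
    forall m, (n < m)%N -> forall x : pres_obj P m, x = 0.
Proof.
elim: n X => [|n IH] X.
  move=> /point_resolution[Q QE]; exists Q => -[//|m] _; rewrite QE.
  exact: zero_bimoduleE.
rewrite syznS => /IH[P P0]; have [Q QE] := splice_resolution P.
by exists Q => -[//|m] nm; rewrite QE; apply: P0.
Qed.

Section Transport.
Variables (M N : bimodule A) (f : bimodhom M N).
Hypotheses (f_inj : injective f) (f_surj : forall y, exists x, f x = y).
Variable P : bimod_projective_resolution M.

Lemma transport_surj m : exists x, bimodcomp f (pres_aug P) x = m.
Proof.
have [y <-] := f_surj m; have [x <-] := pres_aug_surj P y.
by exists x.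
Qed.

Lemma transport_exact0 x :
  bimodcomp f (pres_aug P) x = 0 <-> exists y, x = pres_d P 0 y.
Proof.
rewrite -pres_exact0 bimodcompE; split=> [|->]; last exact: linear0.
by rewrite -(linear0 f) => /f_inj.
Qed.

Definition transport_resolution : bimod_projective_resolution N :=
  @BimodProjectiveResolution k A N (pres_obj P) (bimodcomp f (pres_aug P)) (pres_d P)
    (@pres_projective _ _ _ P) transport_surj transport_exact0 (@pres_exactS _ _ _ P).

End Transport.

Lemma scalar_linear : linear (fun x : yd_triv A => (x : k) *: (1 : regular_bimodule A)).
Proof. by move=> c x y; rewrite scalerDl scalerA. Qed.

Lemma scalar_act (x : yd_triv A) a : linear_of scalar_linear (yd_act x a) =
  \sw_(a1, a2 <- comul a) ract (lact (antipode a1) (linear_of scalar_linear x)) a2.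
Proof.
transitivity ((x : k) *: \sw_(a1, a2 <- comul a) antipode a1 * a2).
  by rewrite antipodel scalerA mulrC.
rewrite sw_scale; apply: eq_sweedler => a1 a2 /=.
by rewrite /ract /= -scalerAr mulr1 -scalerAl.
Qed.

Definition ind_triv : bimodhom (ind (yd_triv A)) (regular_bimodule A) :=
  ind_lift scalar_act.

Lemma ind_trivE b (x : yd_triv A) : ind_triv (b ⊗ x) = (x : k) *: b.
Proof. by rewrite ind_liftE /= -scalerAr mulr1. Qed.

Lemma ind_triv_surj y : exists x, ind_triv x = y.
Proof. by exists (y ⊗ (1 : k^o)); rewrite ind_trivE scale1r. Qed.

Lemma ind_triv_inj : injective ind_triv.
Proof.
apply: (can_inj (g := fun b => b ⊗ (1 : yd_triv A))) => t.
move: t; apply: tensor_ext => [||b x]; try lin.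
by rewrite ind_trivE tensZl -tensZr [X in _ ⊗ X]mulr1.
Qed.

Section Eps.
Variable X : ydmodule A.

Definition eps_lact (a : A) (x : X) : X := (counit a : k) *: x.

Lemma eps_lact_bilinear : bilinear_map eps_lact.
Proof. rewrite /eps_lact; lin. Qed.

Lemma eps_lact1 x : eps_lact 1 x = x.
Proof. by rewrite /eps_lact rmorph1 scale1r. Qed.

Lemma eps_lactM a b x : eps_lact (a * b) x = eps_lact a (eps_lact b x).
Proof. by rewrite /eps_lact counitM scalerA. Qed.

Lemma eps_lractA a x b : yd_act (eps_lact a x) b = eps_lact a (yd_act x b).
Proof. exact: (linearZ_of _ _ ((yd_act_bilinear X).1 b)). Qed.

(** With the left action through the counit, S(a_1) x a_2 is just x a ([eps_ad]), so bimodule maps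
    from A ⊗ Y to this bimodule are the A-linear maps from Y to X. *)
Definition eps_bimodule : bimodule A :=
  @Bimodule k A X eps_lact (@yd_act k A X) eps_lact_bilinear (@yd_act_bilinear k A X)
    eps_lact1 (@yd_act1 k A X) eps_lactM (@yd_actM k A X) eps_lractA.

Lemma eps_ad (x : eps_bimodule) a :
  \sw_(a1, a2 <- comul a) ract (lact (antipode a1) x) a2 = ract x a.
Proof.
rewrite -[RHS](sw_counitl (f := fun u => ract x u)); try lin.
apply: eq_sweedler => a1 a2.
rewrite lractA -[LHS]/((counit (antipode a1) : k) *: ract x a2).
by rewrite counit_antipode.
Qed.

End Eps.

End IndExact.

Section Main.
Variables (k : fieldType) (A : hopfAlgType k).
Hypothesis A_cosemisimple : cosemisimple A.
Local Notation K n := (syzn n (yd_triv A)).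

(** The identity of K_(n+1) must extend to some [g] on K_n ⊠ A, or it would give a nonzero class in
    Ext^(n+1). Subtracting [g] from the identity of K_n ⊠ A yields a map that kills the syzygy,
    hence factors through K_n as a section. *)
Lemma syzn_section n :
  (forall V, ~ yd_Ext_neq0 n.+1 (yd_triv A) V) ->
  exists s : ydhom (K n) (free_yd (K n)), forall x, free_counit (K n) (s x) = x.
Proof.
move=> noExt.
pose id_hom : ydhom (K n.+1) (K n.+1) :=
  @YDHom k A (K n.+1) (K n.+1) idfun (fun _ _ => erefl) (@id_colinear k A (K n.+1)).
have [g gE] : exists g : ydhom (free_yd (K n)) (K n.+1),
    forall x, g (syz_in (K n) x) = id_hom x.
  apply: contrapT => ng; apply: (noExt (K n.+1)).
  exists (cofree_resolution (K n.+1)).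
  exact: (@ext_up k A A_cosemisimple _ (cofree_resolution _) n (yd_triv A) id_hom ng).
pose id_free : ydhom (free_yd (K n)) (free_yd (K n)) :=
  @YDHom k A (free_yd (K n)) (free_yd (K n)) idfun (fun _ _ => erefl)
    (@id_colinear k A (free_yd (K n))).
have [x|s sE] := @free_factor k A (K n) _ (ydsub id_free (ydcomp (syz_in (K n)) g)).
  by rewrite ydsubE ydcompE gE subrr.
exists s => x; rewrite -{1}[x]free_unitK -sE ydsubE ydcompE linearB free_counit_syz.
by rewrite subr0 free_unitK.
Qed.

Lemma resolution_of_section n (s : ydhom (K n) (free_yd (K n))) :
  (forall x, free_counit (K n) (s x) = x) ->
  exists P : bimod_projective_resolution (regular_bimodule A),
    forall m, (n < m)%N -> forall x : pres_obj P m, x = 0.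
Proof.
move=> /ind_projective_of_section/truncated_resolution[P P0].
by exists (transport_resolution (@ind_triv_inj k A) (@ind_triv_surj k A) P).
Qed.

(* The retraction of syz_in is only A-linear. *)
Lemma syzn_retraction n (P : bimod_projective_resolution (regular_bimodule A)) :
  (forall m, (n < m)%N -> forall x : pres_obj P m, x = 0) ->
  exists r : {linear free_yd (K n) -> K n.+1},
    (forall t a, r (yd_act t a) = yd_act (r t) a) /\ forall x, r (syz_in (K n) x) = x.
Proof.
move=> P0; pose Q := transport_resolution (@ind_triv_inj k A) (@ind_triv_surj k A)
  (ind_resolution (yd_triv A)).
pose N := eps_bimodule (K n.+1).
have fE t a : free_counit (K n.+1) (yd_act t a) =
    \sw_(a1, a2 <- comul a) @ract _ _ N (lact (antipode a1) (free_counit (K n.+1) t : N)) a2.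
  by rewrite eps_ad ydhom_act.
(* [G] is the cocycle b ⊗ t |-> counit(b) times the image of t in K_(n+1). The short resolution [P]
   makes it a coboundary of some [F], and F(1 ⊗ -) is the retraction. *)
pose G : bimodhom (pres_obj Q n.+1) N := ind_lift (N := N) fE.
have [x|F FE] := @resolution_extend k A _ Q P n N G (P0 n.+1 (ltnSn n)).
  move: x; apply: (@tensor_ext _ A (free_yd (K n.+2)) _ (fun x => G (pres_d Q n.+1 x))
      (fun=> 0)).
  - lin.
  - by move=> c x y; rewrite scaler0 addr0.
  - move=> b t; rewrite [pres_d _ _ _]ind_res_dE [LHS]ind_liftE free_counit_syz.
    exact: (linear0_of ((lact_bilinear N).2 b)).
have rl : linear (fun t : free_yd (K n) => F ((1 : A) ⊗ t) : K n.+1).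
  have hb := tens_bilinear A (free_yd (K n)).
  by move=> c x y; rewrite hb.2 linearP.
exists (linear_of rl); split=> [t a|x].
  rewrite -[LHS]/(F (1 ⊗ yd_act t a)) -ind_adjoint linear_sweedler.
  rewrite -[RHS](eps_ad (F (1 ⊗ t))); apply: eq_sweedler => a1 a2.
  by rewrite (bimodhom_ract F) (bimodhom_lact F).
have [t <-] : exists t, free_counit (K n.+1) t = x.
  by exists (free_unit (K n.+1) x); rewrite free_unitK.
transitivity (G (1 ⊗ t)); last by rewrite [LHS]ind_liftE lact1.
by rewrite FE; congr (F _); rewrite [RHS]ind_res_dE.
Qed.

Lemma ext_vanishes n (s : ydhom (K n.+1) (free_yd (K n.+1)))
    (P : bimod_projective_resolution (regular_bimodule A)) V :
  (forall x, free_counit (K n.+1) (s x) = x) ->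
  (forall m, (n < m)%N -> forall x : pres_obj P m, x = 0) ->
  ~ yd_Ext_neq0 n.+1 (yd_triv A) V.
Proof.
move=> sE /syzn_retraction[r [r_act rE]] [I [f fne]].
have [g ng] : exists g : ydhom (K n.+1) V, ~ exists g' : ydhom (free_yd (K n)) V,
    forall x, g' (syz_in (K n) x) = g x.
  by apply: (ext_down A_cosemisimple (I := I)); exists f.
apply: ng.
have [h [h1 hinv]] := haar_functional A_cosemisimple.
(* r alone has no free target; s r does, stays A-linear, and restricts to s along [syz_in], so its
   average still does and the counit of K_(n+1) brings it back to the identity. *)
have g_act t a : (s \o r) (yd_act t a) = yd_act ((s \o r) t) a.
  by rewrite /= r_act ydhom_act.
have rs := retract_homE h1 hinv g_act (i := syz_in (K n)) (f := s).
exists (ydcomp g (ydcomp (free_counit (K n.+1)) (retract_hom hinv g_act))) => x.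
rewrite !ydcompE rs; first by rewrite sE.
by move=> y /=; rewrite rE.
Qed.

End Main.

Lemma enat_minP (P : nat -> Prop) n :
  P n -> (forall m, P m -> (n <= m)%N) -> enat_min P = Fin n.
Proof.
move=> Pn minn; rewrite /enat_min; case: pselect => [ex|[]]; last first.
  by exists n; apply/asboolP.
congr Fin; case: ex_minnP => m /asboolP Pm mmin.
by apply/eqP; rewrite eqn_leq minn // mmin //; apply/asboolP.
Qed.

Lemma enat_min_finite (P : nat -> Prop) : enat_min P <> Infty ->
  exists n, [/\ enat_min P = Fin n, P n & forall m, P m -> (n <= m)%N].
Proof.
rewrite /enat_min; case: pselect => [ex _|]; last by [].
case: ex_minnP => n /asboolP Pn minn; exists n; split=> // m Pm.
by apply: minn; apply/asboolP.
Qed.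

Theorem theorem6p4 (k : closedFieldType) (A : hopfAlgType k) :
  cosemisimple A -> cdGS A <> Infty -> cd A = cdGS A.
Proof.
move=> A_cosemisimple /enat_min_finite[n [cdE nmax nmin]].
rewrite /cdGS /enat_max cdE.
have [|s sE] := @syzn_section k A A_cosemisimple n.
  by move=> V Vne; have := nmax n.+1 (ex_intro _ V Vne); rewrite ltnn.
apply: enat_minP; first exact: resolution_of_section sE.
(* For n = 0 the bound is trivial. Otherwise the top degree becomes n+1, and a resolution vanishing
   above m <= n would kill Ext^(n+1), so that n would already bound all nonzero degrees, against the
   minimality of n+1. *)
move=> m [P P0]; case: n => [//|n] in s sE nmax nmin cdE *.
rewrite ltnNge; apply/negP => mn.
have /nmin : forall i, (exists V, yd_Ext_neq0 i (yd_triv A) V) -> (i <= n)%N.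
  move=> i Vi; have := nmax i Vi; rewrite leq_eqVlt => /orP[/eqP iE|//].
  case: Vi => V; rewrite iE => Vne; exfalso; move: Vne.
  apply: (ext_vanishes A_cosemisimple sE (P := P)) => j nj.
  by apply: P0; apply: leq_ltn_trans nj.
by rewrite ltnn.
Qed.
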